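(* Let $G=(V,E)$ be a finite connected simple graph with $|E|\ge 2$. For each $n\ge1$ let $\mathbf{n}$ be a configuration that maximizes $p_G$ among all $\mathbf{n}\in\mathbb{Z}_{\ge0}^E$ with $\sum_{e\in E}n_e=n$. Then $p_G(\mathbf{n})=c_G+o(1)$ as $n\to\infty$.
   Context: Let $k=|V|$. For $F\subset E$ let $\deg_F(v)$ be the number of edges of $F$ incident with $v$, $\deg_G(v)=\deg_E(v)$, and $d(F)=|\{v\in V:\deg_F(v)=\deg_G(v)\}|$. Let $\mathcal{S}_G=\{\mathbf{x}\in\mathbb{R}^E: x_e\ge0,\ \sum_{e\in E}x_e=1\}$ and $$\mathcal{R}_G=\{\mathbf{x}\in\mathcal{S}_G:\ \sum_{e\in F}x_e>\tfrac1k d(F)\ \text{for all } \emptyset\subsetneq F\subsetneq E\}.$$ The game: start from $\mathbf{N}(0)=\mathbf{n}=(n_e:e\in E)\in\mathbb{Z}_{\ge0}^E$, with $n=\sum_{e\in E} n_e$. In each round $t=1,\dots,n$ an independent uniformly random vertex $V_t\in V$ is drawn, the player sees it and must choose an edge $e$ incident with $V_t$, and then $\mathbf{N}(t)=\mathbf{N}(t-1)-\mathbf{1}^e$, where $\mathbf{1}^e$ is the unit coordinate vector of $e$. The player wins if $\mathbf{N}(n)=(0,\dots,0)$. $p_G(\mathbf{n})$ is the probability of winning under the optimal strategy. Equivalently, $p_G(\mathbf{0})=1$, $p_G(\mathbf{n})=0$ if some coordinate of $\mathbf{n}$ is negative, and for other $\mathbf{n}$, $p_G(\mathbf{n})=\frac1k\sum_{v\in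 V}\max_{e\in E:\,e\sim v}p_G(\mathbf{n}-\mathbf{1}^e)$, where $e\sim v$ means $e$ is incident with $v$. $c_G>0$ denotes the constant, depending only on $G$, such that $p_G(\mathbf{n}^{(n)})\to c_G$ as $n\to\infty$ whenever $\mathbf{x}\in\mathcal{R}_G$, $\mathbf{n}^{(n)}\in\mathbb{Z}_{\ge0}^E$, $\sum_{e\in E} n^{(n)}_e=n$ and $\mathbf{n}^{(n)}=n\mathbf{x}+O(1)$ (such a constant exists and is unique). *)

(* Defs.v *)
From HB Require Import structures.
From mathcomp Require Import all_boot all_order all_algebra.
From mathcomp Require Import all_classical all_reals all_analysis.
Import Order.TTheory GRing.Theory Num.Theory.
Import numFieldNormedType.Exports.

Set Implicit Arguments.
Unset Strict Implicit.
Unset Printing Implicit Defensive.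

Local Open Scope ring_scope.

Record sgraph := SGraph {
  vertex :> finType;
  adj : rel vertex;
  adj_sym : symmetric adj;
  adj_irr : irreflexive adj }.

Definition edge_set (G : sgraph) : {set {set G}} :=
  finset (fun f : {set G} =>
    [exists x : G, exists y : G, adj x y && (f == [set x; y]%SET)]).

Definition edge (G : sgraph) : finType := {f : {set G} | f \in edge_set G}.

Definition incident (G : sgraph) (v : G) (f : edge G) : bool := v \in val f.

Definition connected_graph (G : sgraph) : Prop :=
  forall u v : G, connect (@adj G) u v.

Definition deg (G : sgraph) (F : {set edge G}) (v : G) : nat :=
  #|[pred f in F | incident v f]|.

Definition dsat (G : sgraph) (F : {set edge G}) : nat :=
  #|[pred v : G | deg F v == deg [set: edge G]%SET v]|.

Definition in_S (R : realType) (G : sgraph) (x : edge G -> R) : Prop :=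
  (forall f, 0 <= x f) /\ \sum_(f : edge G) x f = 1.

Definition in_R (R : realType) (G : sgraph) (x : edge G -> R) : Prop :=
  in_S x /\
  forall F : {set edge G}, F != finset.set0 -> F != finset.setT ->
    #|G|%:R^-1 * (dsat F)%:R < \sum_(f in F) x f.

(* Configurations live in Z^E, because coordinates may become negative during
   the game; Z_{>=0}^E is carved out by [nonneg]. *)
Definition config (G : sgraph) : zmodType := {ffun edge G -> int}.

Definition nonneg (G : sgraph) (N : config G) : Prop := forall f, 0 <= N f.

Definition size_cfg (G : sgraph) (N : config G) : int := \sum_(f : edge G) N f.

Definition unit_cfg (G : sgraph) (e : edge G) : config G :=
  [ffun f => (f == e)%:R].

(* [s h v] is the edge chosen when the vertex [v] has just been drawn and [h]
   lists the previously drawn vertices in chronological order. *)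
Definition strategy (G : sgraph) := seq G -> G -> edge G.

Definition legal (G : sgraph) (s : strategy G) : Prop :=
  forall h v, incident v (s h v).

(* After the first draw [v], the continuation of [s] is
   [fun h => s (v :: h)]. *)
Fixpoint play (G : sgraph) (s : strategy G) (N : config G) (vs : seq G) :
    config G :=
  if vs is v :: vs' then
    play (fun h => s (v :: h)) (N - unit_cfg (s [::] v)) vs'
  else N.

(* The n draws are independent and uniform, i.e. uniform on V^n. *)
Definition win_prob (R : realType) (G : sgraph) (s : strategy G) (n : nat)
    (N : config G) : R :=
  #|[pred vs : n.-tuple G | play s N vs == 0]|%:R / (#|G| ^ n)%:R.

(* The number of rounds is n = sum_e n_e for N in Z_{>=0}^E; if N has a negative
   coordinate the value is 0 whatever the number of rounds. The supremum is a
   maximum, and satisfies the dynamic programming recursion: see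
   [pG_attained] and [pG_rec]. *)
Definition pG (R : realType) (G : sgraph) (N : config G) : R :=
  sup [set p : R | exists2 s : strategy G,
                     legal s & p = win_prob R s `|size_cfg N|%N N]%classic.

(* [is_cG R G c] says that c is the constant c_G; in the O(1) condition the
   error is bounded uniformly in n and in the coordinates. *)
Definition is_cG (R : realType) (G : sgraph) (c : R) : Prop :=
  0 < c /\
  forall (x : edge G -> R), in_R x ->
  forall N : nat -> config G,
    (forall n, nonneg (N n)) ->
    (forall n, size_cfg (N n) = n%:Z) ->
    (exists C : R, forall n f, `|(N n f)%:~R - n%:R * x f| <= C) ->
  (pG R (N n) @[n --> \oo] --> c)%classic.

Definition maximizes_pG (R : realType) (G : sgraph) (n : nat) (N : config G) :
    Prop :=
  [/\ nonneg N, size_cfg N = n%:Z &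
      forall M : config G, nonneg M -> size_cfg M = n%:Z ->
        pG R M <= pG R N].

Lemma connected_incident (G : sgraph) :
  connected_graph G -> (0 < #|edge G|)%N ->
  forall v : G, exists f : edge G, incident v f.
Proof.
move=> conn /card_gt0P[e0 _] v.
have /[!inE] /existsP[x /existsP[y /andP[xy /eqP e0E]]] := valP e0.
have [vx|vx] := eqVneq v x.
  by exists e0; rewrite /incident e0E vx !inE eqxx.
have /connectP[[|w p] /= pth lst] := conn v x.
  by rewrite lst eqxx in vx.
have /andP[vw _] := pth.
have He : [set v; w]%SET \in edge_set G.
  by rewrite inE; apply/existsP; exists v; apply/existsP; exists w; rewrite vw eqxx.
by exists (exist (fun f => f \in edge_set G) _ He); rewrite /incident /= !inE eqxx.
Qed.

Section Recursion.
Variables (R : realType) (G : sgraph).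
Implicit Types (N : config G) (s : strategy G).

Lemma win_prob0 s N : win_prob R s 0 N = (N == 0)%:R.
Proof.
rewrite /win_prob expn0 divr1; congr (_%:R).
transitivity #|[pred vs : 0.-tuple G | N == 0]|.
  by apply: eq_card => vs; rewrite !inE (tuple0 vs).
by case: (N == 0); rewrite ?card0 // cardT -cardE card_tuple.
Qed.

Lemma win_probS s n N :
  win_prob R s n.+1 N = #|G|%:R^-1 *
    \sum_(v : G) win_prob R (fun h => s (v :: h)) n (N - unit_cfg (s [::] v)).
Proof.
rewrite /win_prob -mulr_suml expnS natrM invfM mulrCA; congr (_ * (_ * _)).
rewrite -natr_sum; congr (_%:R).
rewrite -sum1_card (partition_big (fun vs : n.+1.-tuple G => thead vs) predT) //=.
apply: eq_bigr => v _; rewrite -sum1_card.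
rewrite (reindex (fun t : n.-tuple G => [tuple of v :: t])) /=.
  by apply: eq_bigl => t; rewrite !inE theadE eqxx andbT.
exists (fun t : n.+1.-tuple G => [tuple of behead t]) => [t _|t].
  exact: val_inj.
by case/tupleP: t => u t; rewrite !inE theadE => /andP[_ /eqP ->]; exact: val_inj.
Qed.

Lemma win_prob_ge0 s n N : 0 <= win_prob R s n N.
Proof. by rewrite /win_prob divr_ge0 ?ler0n. Qed.

Fixpoint bellman (n : nat) N : R :=
  if n is n'.+1 then #|G|%:R^-1 *
    \sum_(v : G) \big[Num.max/0]_(f : edge G | incident v f)
       bellman n' (N - unit_cfg f)
  else (N == 0)%:R.

Lemma win_prob_le_bellman n s N : legal s -> win_prob R s n N <= bellman n N.
Proof.
elim: n s N => [|n IH] s N ls; first by rewrite win_prob0.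
rewrite win_probS /= ler_wpM2l ?invr_ge0 ?ler0n //; apply: ler_sum => v _.
apply: le_trans (IH _ _ _) _; first by move=> h u; exact: ls.
by rewrite (bigD1 (s [::] v)) /= ?le_max ?lexx //; exact: ls.
Qed.

Hypothesis noiso : forall v : G, exists f : edge G, incident v f.

Lemma bellman_attained n N :
  exists2 s : strategy G, legal s & win_prob R s n N = bellman n N.
Proof.
elim: n N => [|n IH] N.
  have [g Hg] := boolp.choice noiso.
  by exists (fun _ => g); rewrite ?win_prob0 // => h v; exact: Hg.
have best v : exists p : edge G * strategy G,
    [/\ incident v p.1, legal p.2 &
     win_prob R p.2 n (N - unit_cfg p.1) =
     \big[Num.max/0]_(f : edge G | incident v f) bellman n (N - unit_cfg f)].
  have [f0 vf0] := noiso v.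
  have B0 f : 0 <= bellman n (N - unit_cfg f).
    by have [s _ <-] := IH (N - unit_cfg f); exact: win_prob_ge0.
  rewrite (@bigmax_eq_arg _ _ _ _ f0) //.
  case: Order.TotalTheory.arg_maxP => // f vf _.
  have [s ls ws] := IH (N - unit_cfg f).
  by exists (f, s).
have [g Hg] := boolp.choice best.
pose s : strategy G := fun h v => if h is u :: h' then (g u).2 h' v else (g v).1.
exists s.
  by case=> [|u h] v; [case: (Hg v) | case: (Hg u) => _ + _; exact].
rewrite win_probS /=; congr (_ * _); apply: eq_bigr => v _.
by have [_ _ <-] := Hg v.
Qed.

Lemma pGE N : pG R N = bellman `|size_cfg N|%N N.
Proof.
rewrite /pG; set S := (X in sup X); set B := bellman _ _.
have ubB : ubound S B by move=> _ [s ls ->]; exact: win_prob_le_bellman.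
have SB : S B.
  by have [s ls ws] := bellman_attained `|size_cfg N|%N N; exists s; rewrite ?ws.
apply/eqP; rewrite eq_le; apply/andP; split.
  by apply: ge_sup => //; exists B.
by apply: ub_le_sup => //; exists B.
Qed.

Lemma pG_attained N :
  exists2 s : strategy G, legal s & win_prob R s `|size_cfg N|%N N = pG R N.
Proof. by rewrite pGE; exact: bellman_attained. Qed.

Lemma bellman_neg n N : (exists f, N f < 0) -> bellman n N = 0.
Proof.
elim: n N => [|n IH] N [f Nf] /=.
  by case: eqP => // N0; move: Nf; rewrite N0 ffunE ltxx.
rewrite big1 ?mulr0 // => v _; apply: big1_idem => [|e _]; first exact: maxxx.
apply: IH; exists f; rewrite !ffunE.
by apply: le_lt_trans Nf; rewrite gerBl; case: (_ == _).
Qed.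

Lemma size_cfgB N e : size_cfg (N - unit_cfg e) = size_cfg N - 1.
Proof.
rewrite /size_cfg; under eq_bigr => f _ do rewrite !ffunE.
rewrite sumrB; congr (_ - _).
by rewrite (bigD1 e) //= eqxx big1 ?addr0 // => f /negbTE ->.
Qed.

Lemma pG_rec :
  [/\ pG R (0 : config G) = 1,
      forall N, (exists f, N f < 0) -> pG R N = 0 &
      forall N, nonneg N -> N != 0 ->
        pG R N = #|G|%:R^-1 * \sum_(v : G)
          \big[Num.max/0]_(f : edge G | incident v f) pG R (N - unit_cfg f)].
Proof.
split=> [|N /bellman_neg N0|N N0 Nn0].
- rewrite pGE /size_cfg big1 ?absz0 /= ?eqxx // => f _.
  by rewrite ffunE.
- by rewrite pGE N0.
have : 0 < size_cfg N.
  rewrite lt0r sumr_ge0 ?andbT //; apply: contra Nn0 => /eqP S0.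
  apply/eqP/ffunP => f; rewrite ffunE.
  exact: (psumr_eq0P (fun f _ => N0 f) S0).
rewrite pGE; case E: (size_cfg N) => [[|m]|m] // _ /=.
congr (_ * _); apply: eq_bigr => v _; apply: eq_bigr => f _.
by rewrite pGE size_cfgB E -addn1 PoszD addrK.
Qed.

End Recursion.

(* Main.v *)
Require Import Defs.
From mathcomp Require Import all_boot all_order all_algebra.
From mathcomp Require Import all_classical all_reals all_analysis.
From mathcomp Require Import ring lra zify.
Import Order.TTheory GRing.Theory Num.Theory.
Import numFieldNormedType.Exports.
Local Open Scope ring_scope.

Set Implicit Arguments.
Unset Strict Implicit.
Unset Printing Implicit Defensive.

(** The maximal value of [bellman n] over configurations of size [n] does not
    increase with [n], because each value is a mean of values at the next smaller
    size.  So it has a limit [M], and the theorem says that [M = c].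

    [c <= M] holds because the open region contains a ray: let each vertex
    spread its draws evenly over its edges ([ray_in_R]).  Configurations within
    bounded distance of this ray have values tending to [c].

    [M <= c] rests on the fact that values are a martingale under optimal play.
    Once the maximum has nearly reached its limit, almost all positions met by
    optimal play from a nearly maximal configuration are nearly maximal
    themselves, until the size becomes small.  This is what the predicate
    [for_near_max] exploits.

    The first step is that a nearly maximal configuration tolerates bounded
    changes of load ([near_shift]).  The elementary change takes one unit from an
    edge [g] and puts it, as a token, on an edge [f] ([dipole]).  The modified
    configuration [x + 1^f - 1^g] pursues [x]: it copies an optimal play of [x],
    except that when [x] plays an edge [e] at a vertex where the token lies on an
    adjacent edge, the pursuer may play this edge instead, which moves the token
    to [e].  When the token reaches [g], it cancels and the pursuer has become
    [x].  The token can reach [g] if [x] is large on [g].  For suppose that it could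
    never leave a set [A] of edges without [g].  Then [x] would play in [A] whenever
    possible, and its load on [A] would determine the number of draws at vertices
    touching [A] up to a bounded error.  This has small probability in a long
    run, since the number of such draws spreads out ([spread_small]), unless all
    vertices touch [A]; but in that case [g] would not be played at all.  As it
    is not known in advance which way the token should take, one guesses; a
    guess is correct with probability bounded below, and a wrong one leaves another
    pursuer of the same kind.  Hence the best uniform lower bound [al] for the
    values of pursuers satisfies [al >= al + p * (M - al)] for some [p > 0], that
    is [al >= M].

    Edges whose load stays bounded in nearly maximal configurations need a
    separate treatment, because there a unit must not be removed.  One fixes a
    maximal set [Z] of edges whose loads may be jointly bounded near the maximum;
    the other edges are then automatically heavily loaded ([escape]), and it
    suffices to shift some load onto [Z] ([robust_target]).

    In the second step one fixes a target [z] all of whose neighbours within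
    distance [K] are nearly maximal, and starts very far out on the ray.  Relative
    to the ray, [z] is at a fixed finite distance, and the greedy rule, which
    always plays the edge where the deviation from the line towards [z] is
    largest, has a restoring drift proportional to the deviation
    ([greedy_drift]).  So on average the deviation is bounded by a constant that
    does not depend on [z], and for large [K] the play ends close to [z] with probability
    close to [1].  As the starting values are close to [c], this gives [M <= c]
    ([ray_value_ge]). *)

(** * Means over the drawn vertex and the dynamic programming recursion *)

Section Mean.
Variables (R : realType) (G : sgraph).
Implicit Types F H : G -> R.

Definition mean (F : G -> R) : R := #|G|%:R^-1 * \sum_(v : G) F v.

Lemma ler_mean F H : (forall v, F v <= H v) -> mean F <= mean H.
Proof. by move=> FH; rewrite ler_wpM2l ?invr_ge0 ?ler0n //; exact: ler_sum. Qed.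

Lemma eq_mean F H : F =1 H -> mean F = mean H.
Proof. by move=> FH; congr (_ * _); apply: eq_bigr => v _; exact: FH. Qed.

Lemma meanD F H : mean (fun v => F v + H v) = mean F + mean H.
Proof. by rewrite /mean big_split mulrDr. Qed.

Lemma meanZ (a : R) F : mean (fun v => a * F v) = a * mean F.
Proof. by rewrite /mean -mulr_sumr mulrCA. Qed.

Lemma meanB F H : mean (fun v => F v - H v) = mean F - mean H.
Proof. by rewrite /mean sumrB mulrBr. Qed.

Lemma mean_sum (I : finType) (A : {pred I}) (F : I -> G -> R) :
  mean (fun v => \sum_(i in A) F i v) = \sum_(i in A) mean (F i).
Proof. by rewrite /mean exchange_big -mulr_sumr. Qed.

Lemma mean_sum_nat (n : nat) (F : nat -> G -> R) :
  mean (fun v => \sum_(0 <= i < n) F i v) = \sum_(0 <= i < n) mean (F i).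
Proof. by rewrite /mean exchange_big -mulr_sumr. Qed.

Hypothesis G0 : (0 < #|G|)%N.

Lemma mean_const (a : R) : mean (fun=> a) = a.
Proof.
rewrite /mean sumr_const -[a *+ _]mulr_natl mulrA mulVf ?mul1r //.
by rewrite pnatr_eq0 -lt0n.
Qed.

Lemma mean_ge (a : R) F : (forall v, a <= F v) -> a <= mean F.
Proof. by move=> aF; rewrite -[a]mean_const; exact: ler_mean. Qed.

Lemma mean_le (a : R) F : (forall v, F v <= a) -> mean F <= a.
Proof. by move=> aF; rewrite -[a]mean_const; exact: ler_mean. Qed.

(** No draw can fall far below the mean when none exceeds it by much: every
    single vertex has weight [1 / #|G|]. *)
Lemma mean_near_max (a d : R) F (v : G) :
  (forall u, F u <= a) -> a - d <= mean F -> a - #|G|%:R * d <= F v.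
Proof.
move=> Fa aF; rewrite -subr_ge0.
have -> : F v - (a - #|G|%:R * d) = F v - a + #|G|%:R * d by lra.
have k0 : 0 < #|G|%:R :> R by rewrite ltr0n.
have : #|G|%:R * (a - d) <= \sum_u F u.
  by rewrite -ler_pdivlMl.
rewrite (bigD1 v) //= => h.
have : \sum_(u | u != v) F u <= \sum_(u | u != v) a by exact: ler_sum.
have -> : \sum_(u | u != v) a = #|G|%:R * a - a.
  have -> : #|G|%:R * a = \sum_(u : G) a by rewrite sumr_const mulr_natl.
  by rewrite [in RHS](bigD1 v) //= addrAC subrr add0r.
by move=> h'; lra.
Qed.

End Mean.

Section Play.
Variables (R : realType) (G : sgraph).
Implicit Types (x y : config G) (e f g : edge G).
Local Notation b := (@bellman R G).
Local Notation "'u_ f" := (unit_cfg f) (at level 8, f at level 2).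

Lemma bellmanS n x : b n.+1 x =
  mean (fun v => \big[Num.max/0]_(f : edge G | incident v f) b n (x - 'u_f)).
Proof. by []. Qed.

Lemma bellman_ge0 n x : 0 <= b n x.
Proof.
elim: n x => [|n IH] x /=; first by rewrite ler0n.
rewrite mulr_ge0 ?invr_ge0 ?ler0n // sumr_ge0 // => v _.
apply: (big_ind (fun z : R => 0 <= z)) => // a c a0 _.
by rewrite le_max a0.
Qed.

(** The lower bounds on values below come from rules of play that are not optimal,
    but tied to another play or to a target. *)
Lemma bellmanS_ge n x (e : G -> edge G) : (forall v, incident v (e v)) ->
  mean (fun v => b n (x - 'u_(e v))) <= b n.+1 x.
Proof.
move=> ie; rewrite bellmanS; apply: ler_mean => v.
by rewrite (bigD1 (e v)) ?le_max ?lexx.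
Qed.

Hypothesis noiso : forall v : G, exists f : edge G, incident v f.

Lemma optimal_play : exists opt : nat -> config G -> G -> edge G,
  (forall n x v, incident v (opt n x v)) /\
  (forall n x, b n.+1 x = mean (fun v => b n (x - 'u_(opt n x v)))).
Proof.
have best (p : nat * config G * G) : exists f, incident p.2 f /\
    \big[Num.max/0]_(f : edge G | incident p.2 f) b p.1.1 (p.1.2 - 'u_f) =
    b p.1.1 (p.1.2 - 'u_f).
  case: p => [[n x] v] /=; have [f0 vf0] := noiso v.
  rewrite (@bigmax_eq_arg _ _ _ _ f0) //; last by move=> f _; exact: bellman_ge0.
  by case: Order.TotalTheory.arg_maxP => // f vf _; exists f.
have [h hP] := boolp.choice best.
exists (fun n x v => h (n, x, v)); split=> [n x v|n x].
  by have [] := hP (n, x, v).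
by rewrite bellmanS; apply: eq_mean => v; have [_ /= ->] := hP (n, x, v).
Qed.

Lemma bellman_not_nonneg n x : ~ nonneg x -> b n x = 0.
Proof.
move=> /existsNP[f /negP]; rewrite -ltNge => xf.
by apply: bellman_neg; exists f.
Qed.

Lemma cfgD x y f : (x + y) f = x f + y f.
Proof. by rewrite ffunE. Qed.

Lemma cfgB x y f : (x - y) f = x f - y f.
Proof. by rewrite !ffunE. Qed.

Lemma unit_cfgE e f : 'u_e f = (f == e)%:R.
Proof. by rewrite ffunE. Qed.

Lemma size_cfgD x y : size_cfg (x + y) = size_cfg x + size_cfg y.
Proof. by rewrite /size_cfg -big_split; apply: eq_bigr => f _; rewrite !ffunE. Qed.

Lemma size_unit f : size_cfg 'u_f = 1.
Proof.
rewrite /size_cfg (bigD1 f) //= ffunE eqxx big1 ?addr0 // => g /negbTE gf.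
by rewrite ffunE gf.
Qed.

End Play.

Section Incidence.
Variable G : sgraph.
Implicit Types (e : edge G) (u v : G).

Lemma edge_endpoint e : exists v, incident v e.
Proof.
have := valP e; rewrite inE => /existsP[v /existsP[w /andP[_ /eqP eE]]].
by exists v; rewrite /incident eE !inE eqxx.
Qed.

Lemma adj_edge u v : adj u v -> exists e, incident u e /\ incident v e.
Proof.
move=> uv; have He : [set u; v]%SET \in edge_set G.
  by rewrite inE; apply/existsP; exists u; apply/existsP; exists v; rewrite uv eqxx.
exists (exist (fun s : {set G} => s \in edge_set G) _ He).
by rewrite /incident /= !inE !eqxx orbT.
Qed.

End Incidence.

(** * Anti-concentration of the number of draws in an event *)

Section Spread.
Variables (R : realType) (G : sgraph) (mu : G -> bool).

(** The probability that exactly [z] among [t] independent uniform draws satisfy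
    [mu]. *)
Fixpoint spread (t : nat) (z : int) : R :=
  if t is t'.+1 then mean (fun v => spread t' (z - (mu v)%:Z)) else (z == 0)%:R.

Hypothesis G0 : (0 < #|G|)%N.

Lemma spread_le_step (q : R) t s :
  (forall z, spread t z <= q) -> forall z, spread (s + t) z <= q.
Proof.
move=> tq; elim: s => [|s IH] z //.
by rewrite addSn /=; apply: mean_le.
Qed.

Lemma spread_le1 t z : spread t z <= 1.
Proof.
by rewrite -[t]addn0; apply: spread_le_step => u /=; case: (_ == _); rewrite ?ler01.
Qed.

Lemma sum_spread_le1 t z j : \sum_(i < j) spread t (z - (i : nat)%:Z) <= 1.
Proof.
elim: t z => [|t IH] z /=.
  rewrite -natr_sum -big_mkcond sum1_card -[1]/(1%:R) ler_nat.
  apply/card_le1_eqP => i i' h h'; apply/val_inj/eqP; rewrite -eqz_nat.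
  have /subr0_eq <- : z - (i : nat)%:Z = 0 by exact/eqP/h.
  by have /subr0_eq <- : z - (i' : nat)%:Z = 0 by exact/eqP/h'.
have -> : \sum_(i < j) mean (fun v => spread t (z - (i : nat)%:Z - (mu v)%:Z)) =
    mean (fun v => \sum_(i < j) spread t (z - (mu v)%:Z - (i : nat)%:Z)).
  rewrite (mean_sum (R := R) predT); apply: eq_bigr => i _; apply: eq_mean => v.
  by congr (spread t _); lia.
exact: mean_le.
Qed.

Variables v0 v1 : G.
Hypotheses (mu0 : mu v0 = false) (mu1 : mu v1 = true).

(** Unrolling [mean_near_max] along draws of [v0] and of [v1]: an almost largest
    atom after [j + t] draws forces [j + 1] consecutive ones after [t] draws. *)
Lemma spread_flat t j z (q d : R) : (forall u, spread t u <= q) ->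
  q - d <= spread (j + t) z ->
  forall i, (i <= j)%N -> q - #|G|%:R ^+ j * d <= spread t (z - i%:Z).
Proof.
move=> tq; elim: j z d => [|j IH] z d qd i ij.
  by have -> : z - i%:Z = z; [lia | rewrite expr0 mul1r].
have near v : q - #|G|%:R * d <= spread (j + t) (z - (mu v)%:Z).
  exact: (mean_near_max G0 v (fun u => spread_le_step _ tq (z - (mu u)%:Z))).
have [ij'|ij'] := leqP i j.
  have /IH/(_ _ ij') := near v0.
  by rewrite mu0 subr0 mulrA -exprSr.
have /IH/(_ _ (leqnn j)) := near v1.
rewrite mu1 mulrA -exprSr.
by have -> : z - true%:Z - j%:Z = z - i%:Z by lia.
Qed.

(** Anti-concentration of the number of draws in the event [mu].  If the largest
    atom did not tend to [0], then an almost largest atom at a late time would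
    be surrounded by [j + 1] almost largest atoms a little earlier, whose total
    mass exceeds [1] as soon as [j] is large. *)
Lemma spread_small (e : R) : 0 < e ->
  exists t0, forall t, (t0 <= t)%N -> forall z, spread t z <= e.
Proof.
move=> e0; pose A := [set q : R | exists t, forall z, spread t z <= q]%classic.
have A1 : A 1 by exists 0%N => z; exact: spread_le1.
have lA : has_lbound A.
  exists 0 => q [t tq]; apply: le_trans (tq 0).
  have : forall s z, 0 <= spread s z; last exact.
  elim=> [|s IH] z /=; first by rewrite ler0n.
  by rewrite mulr_ge0 ?invr_ge0 ?ler0n ?sumr_ge0.
have hA : has_inf A by split; [exists 1 |].
suff : inf A < e.
  move=> /(inf_lt hA.1)[q [t0 t0q] qe]; exists t0 => t tt0 z.
  rewrite -(subnK tt0); apply: le_trans (ltW qe).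
  exact: spread_le_step.
rewrite ltNge; apply/negP => eA.
set Q := inf A in eA; have Q0 : 0 < Q by exact: lt_le_trans eA.
pose j := Num.bound (2 / Q).
have jQ : 1 < j.+1%:R * (Q / 2).
  have : 2 / Q < j%:R by rewrite archi_boundP // divr_ge0 // ltW.
  rewrite ltr_pdivrMr // -[j.+1%:R]natr1; move: (j%:R) => a ha.
  have -> : (a + 1) * (Q / 2) = (a * Q + Q) / 2 by rewrite mulrA mulrDl mul1r.
  lra.
have c1 : 1 <= #|G|%:R ^+ j :> R by rewrite exprn_ege1 // ler1n.
set c := #|G|%:R ^+ j in c1.
pose th := Q / (4 * c).
have th0 : 0 < th by rewrite divr_gt0 ?mulr_gt0 //; lra.
have thc : c * th = Q / 4.
  by rewrite /th; field; apply/eqP; lra.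
have /(inf_lt hA.1)[q [t tq] qQ] : inf A < Q + th by rewrite -/Q; lra.
have [z zQ] : exists z, Q - th < spread (j + t) z.
  apply: contrapT => /forallNP zQ.
  suff : Q <= Q - th by move=> ?; lra.
  apply: ge_inf => //; exists (j + t)%N => z.
  by rewrite leNgt; apply/negP/zQ.
have flat i : (i <= j)%N -> Q / 2 <= spread t (z - i%:Z).
  have tq' u : spread t u <= Q + th by apply: le_trans (tq u) _; lra.
  have near : Q + th - 2 * th <= spread (j + t) z by lra.
  move=> /(spread_flat tq' near); apply: le_trans.
  by rewrite -/c; lra.
have := sum_spread_le1 t z j.+1; rewrite leNgt => /negP; apply.
apply: lt_le_trans jQ _.
have -> : j.+1%:R * (Q / 2) = \sum_(i < j.+1) (Q / 2).
  by rewrite sumr_const card_ord mulr_natl.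
by apply: ler_sum => i _; apply: flat; rewrite -ltnS.
Qed.

End Spread.

(** * Plays that never leave a set of edges, and near-maximal configurations *)

Section Stuck.
Variables (R : realType) (G : sgraph).
Implicit Types (x y : config G) (e f g : edge G) (A Z : {set edge G}).
Local Notation "'u_ f" := (unit_cfg f) (at level 8, f at level 2).

Definition touches A (v : G) : bool := [exists f in A, incident v f].

Definition exits A e (v : G) : bool := (e \notin A) && touches A v.

Variable opt : nat -> config G -> G -> edge G.
Hypothesis opt_incident : forall n x v, incident v (opt n x v).

(** The probability that the play [opt] from [x] never exits [A] during [t] rounds
    and ends in a nonnegative configuration; [n0] rounds remain after these. *)
Fixpoint stuck A (n0 t : nat) x : R :=
  if t is t'.+1 then
    mean (fun v => if exits A (opt (t' + n0) x v) v then 0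
                   else stuck A n0 t' (x - 'u_(opt (t' + n0) x v)))
  else [forall f, 0 <= x f]%:R.

Hypothesis G0 : (0 < #|G|)%N.

Lemma size_step n x e : size_cfg x = n.+1%:Z -> size_cfg (x - 'u_e) = n%:Z.
Proof. by rewrite size_cfgB => ->; lia. Qed.

Lemma ler_step x e f : (x - 'u_e) f <= x f.
Proof. by rewrite !ffunE gerBl ler0n. Qed.

Lemma stuck_le_spread A n0 t x : size_cfg x = (t + n0)%:Z ->
  stuck A n0 t x <=
  \sum_(i < n0.+1) spread R (touches A) t (\sum_(f in A) x f - (i : nat)%:Z).
Proof.
have sp0 s z : 0 <= spread R (touches A) s z.
  elim: s z => [|s IH] z /=; first by rewrite ler0n.
  by rewrite mulr_ge0 ?invr_ge0 ?ler0n ?sumr_ge0.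
elim: t x => [|t IH] x sx /=.
  have [/forallP x0|_] := boolP [forall f, 0 <= x f]; last first.
    by apply: sumr_ge0 => i _; rewrite ler0n.
  have xA : 0 <= \sum_(f in A) x f <= n0%:Z.
    apply/andP; split; first exact: sumr_ge0.
    rewrite -[n0%:Z]sx /size_cfg [leRHS](bigID (mem A)) /= lerDl.
    exact: sumr_ge0.
  have [i iA] : exists i : 'I_n0.+1, \sum_(f in A) x f = (i : nat)%:Z.
    move: xA; set s : int := \sum_(f in A) x f; move: s => s sn0.
    have h : (`|s| < n0.+1)%N by lia.
    by exists (Ordinal h) => /=; lia.
  rewrite (bigD1 i) //= iA subrr eqxx lerDl.
  by apply: sumr_ge0 => j _; rewrite ler0n.
rewrite (eq_bigr (fun i : 'I_n0.+1 => mean (fun v => spread R (touches A) t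
    (\sum_(f in A) x f - (touches A v)%:Z - (i : nat)%:Z)))); last first.
  move=> i _; apply: eq_mean => v; congr spread; exact: addrAC.
rewrite -(mean_sum predT); apply: ler_mean => v.
case: ifPn => [_|]; first exact: sumr_ge0.
set e := opt _ _ _ => st.
apply: le_trans (IH _ _) _; first exact: size_step.
apply: ler_sum => i _.
have -> // : \sum_(f in A) (x - 'u_e) f = \sum_(f in A) x f - (touches A v)%:Z.
have -> : \sum_(f in A) (x - 'u_e) f = \sum_(f in A) x f - \sum_(f in A) 'u_e f.
  by rewrite -sumrB; apply: eq_bigr => f _; rewrite !ffunE.
congr (_ - _); have [eA|eA] := boolP (e \in A).
  have -> : touches A v.
    by apply/existsP; exists e; rewrite eA; exact: opt_incident.
  rewrite (bigD1 e) //= ffunE eqxx big1 ?addr0 // => f /andP[_ /negbTE fe].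
  by rewrite ffunE fe.
move: st; rewrite /exits eA /= => /negbTE ->.
apply: big1 => f fA; rewrite ffunE.
by case: eqP => // fe; rewrite -fe fA in eA.
Qed.

Lemma stuck_le_cover A g n0 t x : (forall v, touches A v) -> g \notin A ->
  size_cfg x = (t + n0)%:Z -> n0%:Z < x g -> stuck A n0 t x = 0.
Proof.
move=> cov gA; elim: t x => [|t IH] x sx xg /=.
  rewrite (_ : [forall f, _] = false) //; apply/negP => /forallP x0.
  have : x g <= size_cfg x.
    by rewrite /size_cfg (bigD1 g) //= lerDl sumr_ge0.
  by rewrite sx add0n leNgt xg.
rewrite -[RHS](@mean_const R G G0); apply: eq_mean => v.
rewrite /exits cov andbT; case: ifPn => // /negPn oA.
apply: IH; first exact: size_step.
rewrite !ffunE; case: eqP => [gE|]; last by rewrite subr0.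
by rewrite -gE (negbTE gA) in oA.
Qed.

(** While play never leaves [A], each round lowers the load on [A] by [1] or [0]
    according as the drawn vertex touches [A] or not, so that a surviving
    configuration pins down the number of draws touching [A] up to a bounded
    error.  That is unlikely in a long run, unless every vertex touches [A]; but
    then the edge [g] has not been played at all. *)
Lemma stuck_small A g n0 (d : R) : A != finset.set0 -> g \notin A -> 0 < d ->
  exists t0, forall t x, (t0 <= t)%N -> size_cfg x = (t + n0)%:Z ->
    n0%:Z < x g -> stuck A n0 t x <= d.
Proof.
move=> /set0Pn[f fA] gA d0.
have [v1 v1f] := edge_endpoint f.
have mu1 : touches A v1 by apply/existsP; exists f; rewrite fA.
have [/forallP cov|/forallPn[v0 /negbTE mu0]] :=
    boolP [forall v, touches A v].
  by exists 0%N => t x _ sx xg; rewrite (stuck_le_cover cov gA) // ltW.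
have [|t0 t0P] := @spread_small R G (touches A) G0 v0 v1 mu0 mu1 (d / n0.+1%:R).
  by rewrite divr_gt0.
exists t0 => t x tt0 sx _; apply: le_trans (stuck_le_spread _ sx) _.
have -> : d = \sum_(i < n0.+1) (d / n0.+1%:R).
  by rewrite sumr_const card_ord -[RHS]mulr_natr divfK.
by apply: ler_sum => i _; exact: t0P.
Qed.

End Stuck.

Section NearMax.
Variables (R : realType) (G : sgraph) (M : R).
Implicit Types (x y : config G) (e f g : edge G) (A Z : {set edge G}).
Implicit Types (C L : int) (P Q : nat -> config G -> Prop).
Local Notation b := (@bellman R G).
Local Notation "'u_ f" := (unit_cfg f) (at level 8, f at level 2).

Definition bounded_on Z C x := forall e, e \in Z -> x e <= C.

Definition near_max Z C (d : R) (m n : nat) x : Prop :=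
  [/\ (m <= n)%N, nonneg x, size_cfg x = n%:Z, bounded_on Z C x &
      M - d <= b n x].

(** As a predicate in [P] this is a filter, which [small_set] asserts to be proper
    for some [C]. *)
Definition for_near_max Z C P : Prop :=
  exists2 d : R, 0 < d & exists m, forall n x, near_max Z C d m n x -> P n x.

Definition small_set Z : Prop :=
  exists C, forall (d : R) m, 0 < d -> exists n x, near_max Z C d m n x.

Lemma near_maxW Z C (d d' : R) m m' n x : d' <= d -> (m <= m')%N ->
  near_max Z C d' m' n x -> near_max Z C d m n x.
Proof.
move=> dd mm [mn x0 sx Zx bx]; split=> //; first exact: leq_trans mn.
by apply: le_trans bx; rewrite lerB.
Qed.

Lemma nm_impl Z C P Q : (forall n x, P n x -> Q n x) ->
  for_near_max Z C P -> for_near_max Z C Q.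
Proof. by move=> PQ [d d0 [m H]]; exists d => //; exists m => n x /H/PQ. Qed.

Lemma nm_and Z C P Q : for_near_max Z C P -> for_near_max Z C Q ->
  for_near_max Z C (fun n x => P n x /\ Q n x).
Proof.
move=> [d d0 [m H]] [d' d0' [m' H']].
exists (Num.min d d'); first by rewrite lt_min d0.
exists (maxn m m') => n x nx; split; [apply: H | apply: H'];
  by apply: near_maxW nx; rewrite ?ge_min ?lexx ?orbT ?leq_maxl ?leq_maxr.
Qed.

Lemma nm_self Z C (d : R) m : 0 < d -> for_near_max Z C (near_max Z C d m).
Proof. by move=> d0; exists d => //; exists m. Qed.

Lemma nm_true Z C P : (forall n x, P n x) -> for_near_max Z C P.
Proof. by move=> HP; exists 1 => //; exists 0%N => n x _. Qed.

Lemma nm_forall Z C (T : finType) (P : T -> nat -> config G -> Prop) :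
  (forall t, for_near_max Z C (P t)) ->
  for_near_max Z C (fun n x => forall t, P t n x).
Proof.
move=> HP.
suff : for_near_max Z C (fun n x => forall t, t \in enum T -> P t n x).
  by apply: nm_impl => n x H t; apply: H; rewrite mem_enum.
elim: (enum T) => [|t s IH]; first exact: nm_true.
apply: nm_impl (nm_and (HP t) IH) => n x [Ht Hs] u.
by rewrite inE => /predU1P[-> //|]; exact: Hs.
Qed.

(** If the loads on [e] did not tend to infinity near the maximum, then [e] could be
    added to [Z]. *)
Lemma escape Z C L e : ~ small_set (e |: Z)%SET ->
  for_near_max Z C (fun _ x => L < x e).
Proof.
move=> nS; apply: contrapT => nNM; apply: nS.
exists (Num.max C L) => d m d0; apply: contrapT => none; apply: nNM.
exists d => //; exists m => n x [mn x0 sx Zx bx]; rewrite ltNge; apply/negP => xL.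
apply: none; exists n, x; split=> // f; rewrite !inE le_max => /predU1P[->|fZ].
  by rewrite xL orbT.
by rewrite Zx.
Qed.

Hypothesis M0 : 0 < M.
Hypothesis M_top : forall d : R, 0 < d -> exists m, forall n x, (m <= n)%N ->
  size_cfg x = n%:Z -> b n x <= M + d.

(** A lower bound valid near the maximum becomes an inequality that is affine in
    the value [b n x], at the price of a large coefficient [a].  In this form it
    passes through the mean over the draws. *)
Lemma nm_affine Z C (I : Type) (D : I -> Prop) (Q : I -> nat -> config G -> R)
    (lo k d : R) :
  for_near_max Z C (fun n x => forall i, D i -> k <= Q i n x) ->
  (forall i n x, lo <= Q i n x) -> lo <= k -> 0 < d ->
  exists a0 : R, forall a, a0 <= a -> 0 <= a -> exists m, forall n x i, D i ->
    (m <= n)%N -> size_cfg x = n%:Z -> bounded_on Z C x ->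
    k - d - a * (M - b n x) <= Q i n x.
Proof.
move=> [d1 d10 [m1 H]] Qlo lok d0.
exists ((k - lo) / Num.min d1 M) => a.
rewrite ler_pdivrMr ?lt_min ?d10 // => aP a0.
have [m2 m2P] := M_top (divr_gt0 d0 (ltr_pwDr ltr01 a0)).
exists (maxn m1 m2) => n x i Di; rewrite geq_max => /andP[n1 n2] sx Zx.
have low : k - lo <= a * (M - b n x) -> k - d - a * (M - b n x) <= Q i n x.
  by move=> h; apply: le_trans (Qlo i n x); lra.
have [x0|/bellman_not_nonneg bx] := pselect (nonneg x); last first.
  apply: low; rewrite bx subr0; apply: le_trans aP _.
  by rewrite ler_wpM2l // ge_min lexx orbT.
have [nb|fb] := lerP (M - d1) (b n x); last first.
  apply: low; apply: le_trans aP _.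
  rewrite ler_wpM2l // ge_min; apply/orP; left; lra.
apply: le_trans (H n x _ i Di); last by [].
have := m2P n x n2 sx => top.
have : a * (b n x - M) <= d.
  apply: le_trans (_ : a * (d / (a + 1)) <= _).
    by rewrite ler_wpM2l //; lra.
  rewrite mulrA ler_pdivrMr; last lra.
  nra.
by rewrite mulrBr => h1; rewrite mulrBr; lra.
Qed.

End NearMax.

(** * Pursuing a nearly maximal configuration *)

Lemma commute_step (V : zmodType) (x e f g : V) :
  x + f - g - e = x - e + f - g.
Proof. by rewrite addrAC (addrAC x). Qed.

Lemma transfer_step (V : zmodType) (x e f g : V) :
  x + f - g - f = x + e - g - e.
Proof. by rewrite 2!(addrAC _ (- g)) !addrK. Qed.

(** The maximum of two numbers is at least their mean, so allowing the token to
    move from [f1] to the new edge [e] costs only a factor [2]. *)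
Lemma token_gain (R : realType) (I : finType) (A : {set I}) (e f1 : I)
    (h : I -> R) : e \notin A -> f1 \in A ->
  2^-1 * \sum_(f in (e |: A)%SET) h f + 2^-1 * \sum_(f in A | f != f1) h f <=
  \sum_(f in A) (if f == f1 then Num.max (h f1) (h e) else h f).
Proof.
move=> eA f1A; rewrite big_setU1 //= !(bigD1 (P := mem A) f1) //= eqxx.
have -> : \sum_(f in A | f != f1) (if f == f1 then Num.max (h f1) (h e) else h f)
    = \sum_(f in A | f != f1) h f.
  by apply: eq_bigr => f /andP[_ /negbTE ->].
have : h f1 <= Num.max (h f1) (h e) by rewrite le_max lexx.
have : h e <= Num.max (h f1) (h e) by rewrite le_max lexx orbT.
by lra.
Qed.

Section Chase.
Variables (R : realType) (G : sgraph) (M : R).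
Implicit Types (x y : config G) (e f g : edge G) (A Z : {set edge G}).
Implicit Types (C L : int).
Local Notation b := (@bellman R G).
Local Notation "'u_ f" := (unit_cfg f) (at level 8, f at level 2).
Local Notation nm := (for_near_max M).

Hypothesis noiso : forall v : G, exists f : edge G, incident v f.
Hypothesis G0 : (0 < #|G|)%N.
Hypothesis M0 : 0 < M.
Hypothesis M_top : forall d : R, 0 < d -> exists m, forall n x, (m <= n)%N ->
  size_cfg x = n%:Z -> b n x <= M + d.

Lemma bounded_step Z C x e : bounded_on Z C x -> bounded_on Z C (x - 'u_e).
Proof. by move=> Zx f fZ; apply: le_trans (ler_step _ _ _) (Zx f fZ). Qed.

Section Token.
Variables (g : edge G) (al : R) (A : {set edge G}).
Hypothesis al0 : 0 <= al.

(** The value of the pursuer with its token on [f], relative to a level [al]. *)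
Definition excess f n x : R := b n (x + 'u_f - 'u_g) - al.

Lemma excess_ge f n x : - al <= excess f n x.
Proof. by rewrite lerDr bellman_ge0. Qed.

Lemma excess_step f e n x :
  b n (x + 'u_f - 'u_g - 'u_e) - al = excess f n (x - 'u_e).
Proof. exact: (congr1 (fun y => b n y - al) (commute_step x 'u_e 'u_f 'u_g)). Qed.

(** One round of the chase.  The pursuers [x + 1^f - 1^g], for [f] in [A], copy
    the play [e] of [x].  When [e] lies outside [A] and a pursuer has its token on
    some [f1] in [A] at the same vertex, this pursuer may also play [f1], which
    moves the token to [e]; taking the better of both options is at least as good
    as the average of the tokens over [A] and over [e |: A]. *)
Lemma excess_round (e : G -> edge G) (q : G -> R) n x :
  (forall v, incident v (e v)) ->
  (forall v f1, exits A (e v) v -> f1 \in A -> incident v f1 ->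
    q v <= 2^-1 * \sum_(f in (e v |: A)%SET) excess f n (x - 'u_(e v)) +
           2^-1 * \sum_(f in A | f != f1) excess f n (x - 'u_(e v))) ->
  (forall v, ~~ exits A (e v) v ->
    q v <= \sum_(f in A) excess f n (x - 'u_(e v))) ->
  mean q <= \sum_(f in A) excess f n.+1 x.
Proof.
move=> ie qexit qstay.
have ex_r v : exists rv : edge G -> edge G, (forall f, incident v (rv f)) /\
    q v <= \sum_(f in A) (b n (x + 'u_f - 'u_g - 'u_(rv f)) - al).
  have copy f : excess f n (x - 'u_(e v)) <=
      b n (x + 'u_f - 'u_g - 'u_(e v)) - al.
    by rewrite excess_step lexx.
  have [ex|/qstay qv] := boolP (exits A (e v) v); last first.
    exists (fun=> e v); split; first by move=> f; exact: ie.
    by apply: le_trans qv _; apply: ler_sum => f _; exact: copy.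
  have /andP[eA /existsP[f1 /andP[f1A vf1]]] := ex.
  have move_token : excess (e v) n (x - 'u_(e v)) <=
      b n (x + 'u_f1 - 'u_g - 'u_f1) - al.
    by rewrite (transfer_step x 'u_(e v) 'u_f1 'u_g) excess_step lexx.
  have := le_trans (qexit v f1 ex f1A vf1) (token_gain _ eA f1A) => qv.
  have [le_e|lt_e] :=
    leP (excess f1 n (x - 'u_(e v))) (excess (e v) n (x - 'u_(e v))).
    exists (fun f => if f == f1 then f1 else e v).
    split; first by move=> f; case: ifP => _ //; exact: ie.
    apply: le_trans qv _; apply: ler_sum => f _.
    case: eqP => [-> |_]; last exact: copy.
    by rewrite (max_idPr le_e); exact: move_token.
  exists (fun=> e v); split; first by move=> f; exact: ie.
  apply: le_trans qv _; apply: ler_sum => f _.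
  case: eqP => [-> |_]; last exact: copy.
  by rewrite (max_idPl (ltW lt_e)); exact: copy.
have [r rP] := boolp.choice ex_r.
have : mean q <=
    \sum_(f in A) (mean (fun v => b n (x + 'u_f - 'u_g - 'u_(r v f))) - al).
  apply: le_trans (_ : mean (fun v => \sum_(f in A)
    (b n (x + 'u_f - 'u_g - 'u_(r v f)) - al)) <= _).
    by apply: ler_mean => v; have [] := rP v.
  rewrite mean_sum; apply: ler_sum => f _.
  by rewrite meanB mean_const.
move=> /le_trans; apply; apply: ler_sum => f _.
by rewrite lerB // bellmanS_ge // => v; have [+ _] := rP v; exact.
Qed.

Variables (Z : {set edge G}) (C : int) (ka : R).
Hypotheses (gA : g \notin A) (A0 : A != finset.set0) (ka0 : 0 <= ka).
Hypothesis g_large : forall L, nm Z C (fun _ x => L < x g).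
Hypothesis grown : forall d : R, 0 < d -> nm Z C (fun n x =>
  forall p : edge G * edge G, p.1 \notin A /\ p.2 \in A -> ka - d <=
    2^-1 * \sum_(f in (p.1 |: A)%SET) excess f n x +
    2^-1 * \sum_(f in A | f != p.2) excess f n x).

(** Following an optimal play from [x] until it leaves [A]: [grown] then applies,
    because a nearly maximal value stays nearly maximal along most plays, and
    the plays that never leave [A] have a small total weight by [stuck_small]. *)
Lemma excess_grow (d : R) : 0 < d ->
  nm Z C (fun n x => ka - d <= \sum_(f in A) excess f n x).
Proof.
move=> d0; have [d1 d10 d1E] : exists2 d1 : R, 0 < d1 & d = 4 * d1.
  by exists (d / 4); [rewrite divr_gt0 | lra].
have [opt [oi bopt]] := optimal_play R noiso.
have [s s0 sE] : exists2 s : R, 0 <= s & s = al * #|edge G|%:R.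
  by exists (al * #|edge G|%:R); rewrite ?mulr_ge0.
pose lo := - s - d1.
have sum_lo (D : {pred edge G}) n x : lo + d1 <= \sum_(f in D) excess f n x.
  apply: le_trans (_ : \sum_(f in D) - al <= _); last first.
    by apply: ler_sum => f _; exact: excess_ge.
  rewrite subrK sE sumr_const -[leRHS]mulr_natr mulNr lerN2 ler_wpM2l // ler_nat.
  exact: max_card.
have ka_ge0 := ka0; have lok : lo <= ka - d1 by rewrite /lo; lra.
have := nm_affine M0 M_top (grown d10) _ lok d10.
case=> [p n x|a0 a0P].
  have h1 := sum_lo (p.1 |: A)%SET n x.
  have h2 := sum_lo [pred f in A | f != p.2] n x.
  by rewrite /lo in h1 h2 *; lra.
(* The last bound makes the affine estimate trivial for configurations with a
   negative load, which have value [0]. *)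
pose a := Num.max (Num.max a0 0) ((ka - lo) / M).
have a_a0 : a0 <= a by rewrite !le_max lexx.
have a_ge0 : 0 <= a by rewrite !le_max lexx orbT.
have aM : ka - lo <= a * M by rewrite -ler_pdivrMr // !le_max lexx !orbT.
have [m1 m1P] := a0P a a_a0 a_ge0.
have a1 : 0 < a + 1 by lra.
have [m2 m2P] := M_top (divr_gt0 d10 a1).
have a_small (z : R) : z <= d1 / (a + 1) -> a * z <= d1.
  move=> zd; apply: le_trans (_ : a * (d1 / (a + 1)) <= _).
    by rewrite ler_wpM2l.
  by rewrite mulrA ler_pdivrMr //; nra.
pose n0 := maxn m1 m2; pose B := ka - lo.
have B0 : 0 <= B by rewrite /B /lo; lra.
have chase t x : size_cfg x = (t + n0)%:Z -> bounded_on Z C x ->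
    ka - d1 - d1 - a * (M - b (t + n0) x) - B * stuck R opt A n0 t x <=
    \sum_(f in A) excess f (t + n0) x.
  elim: t x => [|t IH] x sx Zx.
    apply: le_trans (sum_lo (mem A) _ x); rewrite add0n /=.
    have [/forallP x0|/forallP x0] := boolP [forall f, 0 <= x f].
      have := a_small (b n0 x - M); rewrite mulr1 /B => h.
      have {h} : a * (b n0 x - M) <= d1.
        by apply: h; rewrite lerBlDl; apply: m2P => //; rewrite leq_maxr.
      by rewrite !mulrBr => ?; lra.
    by rewrite (bellman_not_nonneg _ _ x0) mulr0 !subr0; lra.
  set e := opt (t + n0)%N x.
  pose q v := if exits A (e v) v
    then ka - d1 - d1 - a * (M - b (t + n0) (x - 'u_(e v)))
    else ka - d1 - d1 - a * (M - b (t + n0) (x - 'u_(e v)))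
         - B * stuck R opt A n0 t (x - 'u_(e v)).
  have sx' v : size_cfg (x - 'u_(e v)) = (t + n0)%:Z by exact: size_step.
  have Zx' v : bounded_on Z C (x - 'u_(e v)) by exact: bounded_step.
  have := @excess_round e q (t + n0) x (oi _ x).
  have -> : mean q = ka - d1 - d1 - a * (M - b (t.+1 + n0) x) -
      B * stuck R opt A n0 t.+1 x.
    rewrite addSn bopt /= -/e.
    transitivity (mean (fun v => (ka - d1 - d1 - a * M)
        + a * b (t + n0) (x - 'u_(e v))
        - B * (if exits A (e v) v then 0
               else stuck R opt A n0 t (x - 'u_(e v))))).
      by apply: eq_mean => v; rewrite /q; case: ifP => _; rewrite mulrBr; lra.
    by rewrite meanB meanD !meanZ mean_const // mulrBr; lra.
  apply=> [v f1 ex f1A vf1|v st].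
    rewrite /q ex; apply: (m1P _ _ (e v, f1)) => //.
      by case/andP: ex.
    by rewrite (leq_trans (leq_maxl m1 m2)) ?leq_addl.
  by rewrite /q (negbTE st); exact: IH.
have [t0 t0P] := stuck_small oi G0 n0 A0 gA (divr_gt0 d10 (ltr_pwDr ltr01 B0)).
have near := nm_self M Z C (t0 + n0) (divr_gt0 d10 a1).
apply: nm_impl (nm_and near (g_large n0%:Z)) => n x [[nt x0 sx Zx bx] xg].
have nE : n = ((n - n0) + n0)%N by rewrite subnK // (leq_trans (leq_addl t0 n0)).
rewrite nE; apply: le_trans (chase _ _ _ Zx); last by rewrite -nE.
rewrite -nE; have := a_small (M - b n x); rewrite lerBlDr -lerBlDl => /(_ bx) h1.
have h2 : B * stuck R opt A n0 (n - n0) x <= d1.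
  apply: le_trans (_ : B * (d1 / (B + 1)) <= _).
    rewrite ler_wpM2l //; apply: t0P => //; last by rewrite -nE.
    by rewrite leq_subRL ?(addnC n0) // (leq_trans (leq_addl t0 n0) nt).
  by rewrite mulrA ler_pdivrMr //; nra.
by lra.
Qed.

End Token.

Variable Z : {set edge G}.
Hypothesis Z_max : forall e, e \notin Z -> ~ small_set M (e |: Z)%SET.

Section Dipole.
Variables (g : edge G) (C : int).
Hypothesis gZ : g \notin Z.

Definition token_value_ge (al : R) : Prop := forall d : R, 0 < d ->
  nm Z C (fun n x => forall f, - d <= excess g al f n x).

Lemma excess_token n x (al : R) : excess g al g n x = b n x - al.
Proof. by rewrite /excess addrK. Qed.

Lemma sum_excess_ge (al d : R) n x (D : {pred edge G}) : 0 < d ->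
  (forall f, - (d / (#|edge G|%:R + 1)) <= excess g al f n x) ->
  - d <= \sum_(f in D) excess g al f n x.
Proof.
move=> d0 H.
apply: le_trans (_ : \sum_(f in D) - (d / (#|edge G|%:R + 1)) <= _); last first.
  by apply: ler_sum => f _; exact: H.
have E1 : 0 < #|edge G|%:R + 1 :> R by rewrite ltr_wpDl.
rewrite sumr_const -[leRHS]mulr_natr mulNr lerN2 -mulrA -[leRHS]mulr1 ler_pM2l //.
rewrite mulrC ler_pdivrMr // mul1r.
by apply: le_trans (_ : #|edge G|%:R <= _); rewrite ?ler_nat ?max_card ?lerDl.
Qed.

(** The total excess over [A] is bounded below by induction on the edges outside
    [A]: once the token may be on [g], where it cancels, the pursuer is [x]
    itself; and each extension of [A] by one edge loses a factor [2]. *)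
Lemma excess_stage (al : R) : 0 <= al <= M -> token_value_ge al ->
  forall A, A != finset.set0 -> forall d : R, 0 < d ->
  nm Z C (fun n x =>
    2^-1 ^+ #|~: A|%SET * (M - al) - d <= \sum_(f in A) excess g al f n x).
Proof.
move=> /andP[al0 alM] LB A; move: {2}#|~: A|%SET (erefl #|~: A|%SET) => k.
have E1 : 0 < #|edge G|%:R + 1 :> R by rewrite ltr_wpDl.
have at_g (B : {set edge G}) (d : R) : g \in B -> 0 < d -> nm Z C (fun n x =>
    2^-1 ^+ #|~: B|%SET * (M - al) - d <= \sum_(f in B) excess g al f n x).
  move=> gB d0; have d20 : 0 < d / 2 by rewrite divr_gt0.
  apply: nm_impl (nm_and (nm_self M Z C 0 d20) (LB _ (divr_gt0 d20 E1))).
  move=> n x [[_ _ _ _ bx] H]; rewrite (bigD1 g) //= excess_token.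
  have := sum_excess_ge [pred f in B | f != g] d20 H.
  have : 2^-1 ^+ #|~: B|%SET * (M - al) <= M - al.
    by rewrite ler_piMl ?subr_ge0 // exprn_ile1 ?invr_ge0 ?invf_le1 ?ler1n.
  move: bx; move: (b n x) (\sum_(f in _ | _) _) (_ ^+ _ * _) => u v w.
  by lra.
elim: k A => [|k IH] A cA A0 d d0.
  apply: at_g => //; move/eqP: cA; rewrite cards_eq0 => /eqP/setP/(_ g).
  by rewrite !inE => /negbFE.
have [gA|gA] := boolP (g \in A); first exact: at_g.
have ka0 : 0 <= 2^-1 ^+ #|~: A|%SET * (M - al).
  by rewrite mulr_ge0 ?exprn_ge0 ?invr_ge0 ?subr_ge0.
apply: excess_grow => // [L|d' d'0]; first exact: escape (Z_max gZ).
have IH' : nm Z C (fun n x => forall e, e \notin A ->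
    2^-1 ^+ k * (M - al) - d' <= \sum_(f in (e |: A)%SET) excess g al f n x).
  apply: nm_forall => e; have [eA|eA] := boolP (e \in A).
    exact: nm_true.
  have cA' : #|~: (e |: A)|%SET = k.
    have := cardsC (e |: A)%SET; have := cardsC A; rewrite cardsU1 eA cA.
    by clear; lia.
  have A'0 : (e |: A)%SET != finset.set0.
    by apply/set0Pn; exists e; rewrite !inE eqxx.
  by apply: nm_impl (IH _ cA' A'0 _ d'0) => n x; rewrite cA'.
apply: nm_impl (nm_and IH' (LB _ (divr_gt0 d'0 E1))) => n x [H1 H2] [e f1] /=.
move=> [eA f1A]; have := H1 e eA.
have := sum_excess_ge [pred f in A | f != f1] d'0 H2.
rewrite cA exprS -mulrA; move: (_ * (M - al)) => u.
move: (\sum_(f in (e |: A)%SET) _) (\sum_(f in _ | _) _) => v w.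
clear E1 ka0.
by lra.
Qed.

(** Taking a single edge for [A] in [excess_stage] improves any level reached by
    all pursuers. *)
Lemma token_value_improve (al : R) : 0 <= al <= M -> token_value_ge al ->
  token_value_ge (al + 2^-1 ^+ #|edge G|.-1 * (M - al)).
Proof.
move=> al0M LB d d0; apply: nm_forall => f.
have f0 : [set f]%SET != finset.set0 by apply/set0Pn; exists f; rewrite inE.
apply: nm_impl (excess_stage al0M LB f0 d0) => n x.
rewrite big_set1 cardsC1 /excess.
by move: (_ ^+ _ * _) (b n _) => u v; lra.
Qed.

(** The supremum of the levels reached by all pursuers is itself reached, and an
    improvement of it is impossible unless it is [M]. *)
Lemma token_value_top : token_value_ge M.
Proof.
have M_gt0 := M0; pose S := [set al : R | 0 <= al <= M /\ token_value_ge al]%classic.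
have S0 : S 0.
  split; first by rewrite lexx ltW.
  move=> d d0; apply: nm_true => n x f.
  by rewrite /excess subr0 (le_trans _ (bellman_ge0 _ _ _)) // oppr_le0 ltW.
have uS : ubound S M by move=> al [/andP[]].
have hS : has_sup S by split; [exists 0 | exists M].
set s := sup S; have s0 : 0 <= s by apply: ub_le_sup => //; exists M.
have sM : s <= M by apply: ge_sup => //; exists 0.
have Ls : token_value_ge s.
  move=> d d0; have d20 : 0 < d / 2 by rewrite divr_gt0.
  have [al [_ LB] als] := sup_adherent d20 hS.
  apply: nm_impl (LB _ d20) => n x H f; have := H f; rewrite /excess.
  by move: als; rewrite -/s; move: (b n _) (s) => v r; lra.
have := token_value_improve _ Ls; rewrite s0 sM => /(_ isT).
have : 0 < 2^-1 ^+ #|edge G|.-1 :> R by rewrite exprn_gt0 // invr_gt0.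
have : 2^-1 ^+ #|edge G|.-1 <= 1 :> R.
  by rewrite exprn_ile1 ?invr_ge0 ?invf_le1 ?ler1n.
move: (_ ^+ _) => p p1 p0 Lp.
have : s + p * (M - s) <= s.
  apply: ub_le_sup; first by exists M.
  split=> //; move: s0 sM; rewrite -/s; move: (s) => r r0 rM.
  by apply/andP; split; nra.
rewrite gerDl pmulr_rle0 // subr_le0 => Ms.
suff -> : M = s by [].
by apply/eqP; rewrite eq_le Ms sM.
Qed.

End Dipole.

(** In nearly maximal configurations a unit of load may be moved away from any edge
    that is heavily loaded there, at asymptotically no cost. *)
Lemma dipole g C (d : R) : g \notin Z -> 0 < d ->
  nm Z C (fun n x => forall f, M - d <= b n (x + 'u_f - 'u_g)).
Proof.
move=> gZ d0; apply: nm_impl (token_value_top C gZ d0) => n x H f.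
by have := H f; rewrite /excess; move: (b n _) => v; lra.
Qed.

End Chase.

(** * Targets surrounded by nearly maximal configurations *)

Section Robust.
Variables (R : realType) (G : sgraph) (M : R).
Implicit Types (x y z : config G) (e f g : edge G) (Z : {set edge G}).
Implicit Types (C : int).
Local Notation b := (@bellman R G).
Local Notation "'u_ f" := (unit_cfg f) (at level 8, f at level 2).
Local Notation nm := (for_near_max M).

Hypothesis noiso : forall v : G, exists f : edge G, incident v f.
Hypothesis G0 : (0 < #|G|)%N.
Hypothesis M0 : 0 < M.
Hypothesis M_top : forall d : R, 0 < d -> exists m, forall n x, (m <= n)%N ->
  size_cfg x = n%:Z -> b n x <= M + d.
Hypothesis M_near : forall n, (0 < n)%N ->
  exists x, [/\ nonneg x, size_cfg x = n%:Z & M <= b n x].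

Lemma transfer_split x (d : config G) f g :
  x + d = x + 'u_f - 'u_g + (d - 'u_f + 'u_g).
Proof.
have h (V : zmodType) (a c u w : V) : a + c = a + u - w + (c - u + w).
  by rewrite addrACA addNr addr0 addrACA subrr addr0.
exact: h.
Qed.

Lemma size_cfg0_split (d : config G) : size_cfg d = 0 -> d != 0 ->
  exists f g, 0 < d f /\ d g < 0.
Proof.
have pos (h : config G) : size_cfg h = 0 -> h != 0 -> exists f, 0 < h f.
  move=> sh h0; apply: contrapT => /forallNP hN.
  have hle f : 0 <= - h f by rewrite oppr_ge0 leNgt; apply/negP.
  case/eqP: h0; apply/ffunP => f; rewrite ffunE.
  have : \sum_f - h f = 0 by rewrite sumrN -/(size_cfg h) sh oppr0.
  by move=> /(psumr_eq0P (fun f _ => hle f))/(_ f isT)/eqP; rewrite oppr_eq0 => /eqP.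
move=> sd d0; have [f df] := pos d sd d0.
have [g dg] : exists g, 0 < (- d) g.
  apply: pos; last by rewrite oppr_eq0.
  rewrite /size_cfg (eq_bigr (fun f => - d f)); last by move=> h _; rewrite !ffunE.
  by rewrite sumrN -/(size_cfg d) sd oppr0.
by exists f, g; split=> //; move: dg; rewrite !ffunE oppr_gt0.
Qed.

Section Shift.
Variable Z : {set edge G}.
Hypothesis Z_max : forall e, e \notin Z -> ~ small_set M (e |: Z)%SET.

(** A bounded change of load that does not deplete the edges of [Z] is a
    composite of dipoles whose negative ends lie outside [Z]. *)
Lemma near_shift (d : config G) : size_cfg d = 0 ->
  (forall e, e \in Z -> 0 <= d e) ->
  forall C (ep : R), 0 < ep -> nm Z C (fun n x => M - ep <= b n (x + d)).
Proof.
move: {2}(\sum_e `|d e|)%N (leqnn (\sum_e `|d e|)%N) => k.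
elim: k d => [|k IH] d dk sd dZ C ep ep0; have [d0|d0] := eqVneq d 0.
1,3: apply: nm_impl (nm_self M Z C 0 ep0) => n x [_ _ _ _].
1,2: by rewrite d0 addr0.
all: have [f [g [df dg]]] := size_cfg0_split sd d0.
  by move: dk; rewrite (bigD1 f) //= leqn0 addn_eq0 absz_eq0 => /andP[/eqP df0 _];
    rewrite df0 ltxx in df.
have gZ : g \notin Z by apply/negP => /dZ; rewrite leNgt dg.
have fg : f != g by apply/eqP => fgE; move: df dg; rewrite fgE; lia.
pose d' : config G := d - 'u_f + 'u_g.
have d'E e : d' e = d e - (e == f)%:R + (e == g)%:R by rewrite cfgD cfgB !unit_cfgE.
have d'k : (\sum_e `|d' e| <= k)%N.
  rewrite -ltnS; apply: leq_trans dk.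
  rewrite (bigD1 f) //= [X in (_ < X)%N](bigD1 f) //= -addSn leq_add //.
    by rewrite d'E eqxx (negbTE fg) /=; move: (d f : int) df => a; lia.
  apply: leq_sum => e /negbTE ef; rewrite d'E ef.
  by have [->|_] := eqVneq e g => /=; [move: (d g : int) dg | move: (d e : int)];
    move=> a; lia.
have sd' : size_cfg d' = 0.
  by rewrite size_cfgD size_cfgB sd size_unit.
have d'Z e : e \in Z -> 0 <= d' e.
  move=> eZ; have := dZ e eZ; rewrite d'E.
  have [->|_] := eqVneq e f; [move: df; move: (d f : int) | move: (d e : int)];
    by case: (_ == g) => /= a; lia.
have [de de0 [m H]] := IH d' d'k sd' d'Z (C + 1) ep ep0.
have dip := dipole noiso G0 M0 M_top Z_max C gZ de0.
have large := escape C 0 (Z_max gZ).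
apply: nm_impl (nm_and (nm_self M Z C m ltr01) (nm_and dip large)).
move=> n x [[mn x0 sx Zx _] [/(_ f) bx xg]].
rewrite (transfer_split x d f g); apply: H; split=> //.
- move=> e; rewrite cfgB cfgD !unit_cfgE; have [->|_] := eqVneq e g.
    by rewrite eq_sym (negbTE fg) /=; move: (x g : int) xg => a; lia.
  by case: (_ == _) => /=; move: (x e : int) (x0 e) => a; lia.
- by rewrite size_cfgB size_cfgD sx size_unit addrK.
- move=> e eZ; rewrite cfgB cfgD !unit_cfgE.
  move: (x e : int) (Zx e eZ) => a.
  by case: (_ == _); case: (_ == _) => /=; lia.
Qed.

Lemma near_ball C (K : nat) (ep : R) : 0 < ep -> nm Z C (fun n x =>
  forall d : config G, size_cfg d = 0 -> (forall e, e \in Z -> 0 <= d e) ->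
    (forall e, `|d e| <= K%:Z) -> M - ep <= b n (x + d)).
Proof.
move=> ep0.
pose dec (t : {ffun edge G -> 'I_(K + K).+1}) : config G :=
  [ffun e => (t e : nat)%:Z - K%:Z].
have : nm Z C (fun n x => forall t, size_cfg (dec t) = 0 ->
    (forall e, e \in Z -> 0 <= dec t e) -> M - ep <= b n (x + dec t)).
  apply: nm_forall => t.
  have [[s0 tZ]|no] := pselect (size_cfg (dec t) = 0 /\
      forall e, e \in Z -> 0 <= dec t e).
    by apply: nm_impl (near_shift s0 tZ C ep0).
  by apply: nm_true => n x s0 tZ; case: no.
apply: nm_impl => n x H d sd dZ dK.
pose t : {ffun edge G -> 'I_(K + K).+1} := [ffun e => inord `|(d e + K%:Z)%R|%N].
have dE : d = dec t.
  apply/ffunP => e; rewrite !ffunE; move: (d e : int) (dK e) => a aK.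
  by rewrite inordK; lia.
by rewrite dE; apply: H; rewrite -dE.
Qed.

End Shift.

(** There are targets around which every configuration is nearly maximal: take a
    nearly maximal configuration and shift it towards the edges of a maximal
    small set, at the expense of one edge outside this set. *)
Lemma robust_target (K : nat) (ep : R) : 0 < ep ->
  exists m z, size_cfg z = m%:Z /\ forall y, size_cfg y = m%:Z ->
    (forall e, `|(y - z) e| <= K%:Z) -> M - ep <= b m y.
Proof.
move=> ep0.
have [Z /maxsetP[/asboolP Zs Zmax]] :
    {Z | maxset (fun Z : {set edge G} => `[< small_set M Z >]) Z}.
  apply: ex_maxset; exists finset.set0; apply/asboolP; exists 0 => d m d0.
  have [x [x0 sx bx]] := M_near (ltn0Sn m).
  exists m.+1, x; split=> //; first by move=> e; rewrite inE.
  by apply: le_trans bx; rewrite gerBl ltW.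
have Z_max e : e \notin Z -> ~ small_set M (e |: Z)%SET.
  move=> eZ eZs; have eq_Z : (e |: Z)%SET = Z.
    by apply: Zmax; [exact/asboolP | exact: finset.subsetUr].
  by move: eZ; rewrite -eq_Z !inE eqxx.
have [C near] := Zs.
have [g gZ] : exists g, g \notin Z.
  apply: contrapT => /forallNP allZ.
  have [n [x [mn _ sx Zx _]]] := near 1 (`|C| * #|edge G|).+1 ltr01.
  have : size_cfg x <= \sum_(e : edge G) C.
    by apply: ler_sum => e _; apply: Zx; apply/negPn/negP/allZ.
  rewrite sx sumr_const -mulr_natr; move: mn; move: #|edge G| => E mn.
  have : C * E%:R <= `|C|%:Z * E%:Z by rewrite natz ler_wpM2r //; lia.
  lia.
(* On [Z] the shift is [K], and on [g] it is at most [K] times the number of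
   edges; the other [K] is the distance of [y] from the target. *)
have [d d0 [m H]] := near_ball Z_max C (K + K + K * #|edge G|) ep0.
have [n [x xn]] := near d m d0.
pose s : config G := [ffun e => if e \in Z then K%:Z
                      else if e == g then - (K * #|Z|)%:Z else 0].
have ss : size_cfg s = 0.
  rewrite /size_cfg (bigID (mem Z)) /=.
  rewrite (eq_bigr (fun=> K%:Z)) => [|e eZ]; last by rewrite ffunE eZ.
  rewrite [X in _ + X](eq_bigr (fun e => if e == g then - (K * #|Z|)%:Z else 0)).
    rewrite -big_mkcondr /= sumr_const [X in _ + X](big_pred1 g).
      by rewrite PoszM -[X in X - _]mulr_natr natz subrr.
    by move=> e /=; case: eqP => [->|]; rewrite ?gZ ?andbF.
  by move=> e eZ; rewrite ffunE (negbTE eZ).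
have sE e : s e = if e \in Z then K%:Z
    else if e == g then - (K * #|Z|)%:Z else 0 by rewrite ffunE.
exists n, (x + s); have [_ _ sx _ _] := xn.
split=> [|y sy yK]; first by rewrite size_cfgD ss addr0.
have -> : y = x + (y - x) by rewrite addrC subrK.
have dE e : (y - x) e = (y - (x + s)) e + s e.
  by rewrite !cfgB cfgD opprD -!addrA addNr addr0.
apply: (H n x xn).
- rewrite size_cfgD sy; have := size_cfgD x (- x); rewrite subrr sx.
  rewrite {1}/size_cfg big1 => [|e _]; last by rewrite ffunE.
  by move: (size_cfg (- x)) => u /esym.
- move=> e eZ; rewrite dE sE eZ; move: (yK e).
  by move: ((y - (x + s)) e : int) => a; lia.
move=> e; rewrite dE sE; move: (yK e) (max_card (mem Z)).
move: ((y - (x + s)) e : int) #|edge G| #|mem Z| => a E z aK zE.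
have : (K * z <= K * E)%N by rewrite leq_mul2l zE orbT.
by case: ifP => _; [|case: ifP => _]; lia.
Qed.

End Robust.

(** * A ray in the open region *)

Section Oscillation.
Variables (R : realType) (G : sgraph).
Implicit Types (e f g : edge G) (u v : G) (d : edge G -> R).

Variables (d : edge G -> R) (top : G -> edge G).
Hypothesis top_ge : forall v e, incident v e -> d e <= d (top v).

(** How far [d] is from being constant on the edges at each vertex. *)
Definition slack : R :=
  \sum_(v : G) \sum_(e : edge G | incident v e) (d (top v) - d e).

Lemma slack_term v e : incident v e -> d (top v) - d e <= slack.
Proof.
move=> ve; rewrite /slack (bigD1 v) //= (bigD1 e) //=.
rewrite -addrA lerDl addr_ge0 // sumr_ge0 // => [f /andP[vf _]|u _].
  by rewrite subr_ge0 top_ge.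
by rewrite sumr_ge0 // => f uf; rewrite subr_ge0 top_ge.
Qed.

Lemma slack_ge0 : 0 <= slack.
Proof.
by rewrite sumr_ge0 // => v _; rewrite sumr_ge0 // => e ve; rewrite subr_ge0 top_ge.
Qed.

Lemma top_path u (p : seq G) : path (@adj G) u p ->
  d (top u) <= d (top (last u p)) + (size p)%:R * slack.
Proof.
elim: p u => [|v p IH] u /=; first by rewrite mul0r addr0.
move=> /andP[uv /IH IHp]; have [e [ue ve]] := adj_edge uv.
have := slack_term ue; have := top_ge ve; rewrite -natr1 mulrDl mul1r.
by move: IHp; move: (_ * slack) => r; lra.
Qed.

Hypothesis conn : connected_graph G.

(** Walking along a path of the graph, the largest value of [d] at a vertex
    drops at each step by at most a summand of [slack]. *)
Lemma oscillation e e' : d e - d e' <= #|G|.+1%:R * slack.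
Proof.
have [v ve] := edge_endpoint e; have [v' ve'] := edge_endpoint e'.
have /connectP[p pth v'p] := conn v v'.
case/shortenP: pth v'p => q qth uq _ v'q.
have := top_path qth; rewrite -v'q.
have : (size q)%:R * slack <= #|G|%:R * slack.
  rewrite ler_wpM2r ?slack_ge0 // ler_nat.
  have := card_uniqP uq => /= cq.
  by apply: ltnW; rewrite -[(size q).+1]cq; exact: max_card.
have := top_ge ve; have := slack_term ve'; rewrite -natr1 mulrDl mul1r.
by move: (_ * slack) (_ * slack) => r r'; lra.
Qed.

Lemma norm1_slack : \sum_e d e = 0 ->
  \sum_e `|d e| <= #|edge G|%:R * (#|G|.+1%:R * slack).
Proof.
move=> d0; apply: le_trans (_ : \sum_(e : edge G) #|G|.+1%:R * slack <= _); last first.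
  by rewrite sumr_const [leRHS]mulr_natl.
apply: ler_sum => e _; have := oscillation; move: (#|G|.+1%:R * slack) => r osc.
have E0 : 0 < #|edge G|%:R :> R by rewrite ltr0n; apply/card_gt0P; exists e.
have sum_e : \sum_f (d e - d f) = #|edge G|%:R * d e.
  by rewrite sumrB d0 subr0 sumr_const mulr_natl.
have sum_r : \sum_(f : edge G) r = #|edge G|%:R * r by rewrite sumr_const mulr_natl.
rewrite ler_norml; apply/andP; split.
  rewrite lerNl -(ler_pM2l E0) mulrN -sum_e -sum_r -sumrN.
  by apply: ler_sum => f _; rewrite opprB osc.
by rewrite -(ler_pM2l E0) -sum_e -sum_r; apply: ler_sum => f _; exact: osc.
Qed.

End Oscillation.

Section Ray.
Variables (R : realType) (G : sgraph).
Implicit Types (e f g : edge G) (u v : G) (d : edge G -> R).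

(** Scaled by [period], the ray is integral: out of [period] draws each vertex
    receives [degree_prod] on average and gives [draw_share] to each of its
    edges. *)
Definition degree_prod : nat := \prod_(v : G) deg [set: edge G]%SET v.
Definition draw_share v : nat := degree_prod %/ deg [set: edge G]%SET v.
Definition edge_load e : nat := \sum_(v | incident v e) draw_share v.
Definition period : nat := #|G| * degree_prod.
Definition ray e : R := (edge_load e)%:R / period%:R.

Hypothesis conn : connected_graph G.
Hypothesis noiso : forall v : G, exists f : edge G, incident v f.
Hypothesis G0 : (0 < #|G|)%N.

Lemma deg_setT v : deg [set: edge G]%SET v = #|[pred e | incident v e]|.
Proof. by apply: eq_card => e; rewrite !inE. Qed.

Lemma deg_gt0 v : (0 < deg [set: edge G]%SET v)%N.
Proof.
by have [f vf] := noiso v; rewrite deg_setT; apply/card_gt0P; exists f.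
Qed.

Lemma degree_prod_gt0 : (0 < degree_prod)%N.
Proof. by rewrite prodn_gt0 // => v; exact: deg_gt0. Qed.

Lemma draw_shareK v : (draw_share v * deg [set: edge G]%SET v)%N = degree_prod.
Proof. by rewrite divnK // /degree_prod (bigD1 v) //= dvdn_mulr. Qed.

Lemma draw_share_gt0 v : (0 < draw_share v)%N.
Proof.
by have := degree_prod_gt0; rewrite -(draw_shareK v) muln_gt0 => /andP[].
Qed.

Lemma period_gt0 : (0 < period)%N.
Proof. by rewrite muln_gt0 G0 degree_prod_gt0. Qed.

Lemma exchange_load (h : edge G -> R) : \sum_e h e * (edge_load e)%:R =
  \sum_(v : G) (draw_share v)%:R * \sum_(e | incident v e) h e.
Proof.
transitivity (\sum_e \sum_(v | incident v e) h e * (draw_share v)%:R).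
  by apply: eq_bigr => e _; rewrite /edge_load natr_sum mulr_sumr.
rewrite (exchange_big_dep predT) //=; apply: eq_bigr => v _.
by rewrite mulr_sumr; apply: eq_bigr => e _; rewrite mulrC.
Qed.

Lemma period_ne0 : period%:R != 0 :> R.
Proof. by rewrite pnatr_eq0 -lt0n period_gt0. Qed.

Lemma rayM e : ray e * period%:R = (edge_load e)%:R.
Proof. by rewrite divfK // period_ne0. Qed.

Lemma ray_ge0 e : 0 <= ray e.
Proof. by rewrite divr_ge0. Qed.

Lemma sum_ray : \sum_e ray e = 1.
Proof.
apply: (mulIf period_ne0); rewrite mul1r mulr_suml.
transitivity (\sum_e 1 * (edge_load e)%:R : R).
  by apply: eq_bigr => e _; rewrite rayM mul1r.
rewrite exchange_load; transitivity (\sum_(v : G) degree_prod%:R : R).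
  by apply: eq_bigr => v _; rewrite sumr_const -deg_setT -natrM draw_shareK.
by rewrite sumr_const /period natrM mulr_natl.
Qed.

Lemma ray_le1 e : ray e <= 1.
Proof. by rewrite -sum_ray (bigD1 e) //= lerDl sumr_ge0 // => f _; exact: ray_ge0. Qed.

(** The ray lies in the open region because, by connectedness, some vertex meets
    both [F] and its complement, so that [F] gets a positive share of the draws
    of this vertex although it is not counted in [dsat F]. *)
Lemma ray_in_R : in_R ray.
Proof.
split; first by split; [exact: ray_ge0 | exact: sum_ray].
move=> F /set0Pn[e eF] FT.
have [e' e'F] : exists e', e' \notin F.
  apply: contrapT => /forallNP allF; case/eqP: FT; apply/setP => f.
  by rewrite inE; apply/negPn/negP/allF.
pose d f : R := (f \in F)%:R.
have ex_top v : exists t, incident v t /\ forall f, incident v f -> d f <= d t.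
  have [f0 vf0] := noiso v.
  case: (@Order.TotalTheory.arg_maxP _ _ _ f0 (incident v) d vf0) => t vt tmax.
  by exists t; split.
have [top topP] := boolp.choice ex_top.
have [v [vtop [f [vf fF]]]] : exists v, top v \in F /\
    exists f, incident v f /\ f \notin F.
  apply: contrapT => none.
  have := @oscillation R G d top (fun v f vf => (topP v).2 f vf) conn e e'.
  rewrite /d eF (negbTE e'F) subr0 /slack big1 ?mulr0 ?ler10 // => v _.
  apply: big1 => f vf; apply/eqP; rewrite subr_eq0.
  have := (topP v).2 f vf; rewrite /d.
  have [tF|tF] := boolP (top v \in F); have [fF|fF] := boolP (f \in F) => //.
    by move=> _; case: none; exists v; split=> //; exists f.
  by rewrite ler10.
rewrite -(ltr_pM2r (_ : 0 < period%:R)) ?ltr0n ?period_gt0 //.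
have -> : #|G|%:R^-1 * (dsat F)%:R * period%:R =
    \sum_(u | deg F u == deg [set: edge G]%SET u) (degree_prod%:R : R).
  rewrite sumr_const /period natrM mulrACA mulVf ?pnatr_eq0 -?lt0n //.
  by rewrite mul1r mulr_natl.
have -> : (\sum_(h in F) ray h) * period%:R =
    \sum_u (draw_share u)%:R * (deg F u)%:R.
  rewrite mulr_suml.
  transitivity (\sum_h (h \in F)%:R * (edge_load h)%:R : R).
    rewrite big_mkcond; apply: eq_bigr => h _.
    by case: (h \in F); rewrite ?mul0r // mul1r rayM.
  rewrite exchange_load; apply: eq_bigr => u _; congr (_ * _).
  rewrite /deg -sum1_card natr_sum big_mkcond [RHS]big_mkcond /=.
  by apply: eq_bigr => h _; rewrite !inE andbC; case: (incident u h); case: (h \in F).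
have degF u : (deg F u <= deg [set: edge G]%SET u)%N.
  rewrite deg_setT; apply: subset_leq_card; apply/fintype.subsetP => h.
  by rewrite !inE => /andP[].
have le_u u : (if deg F u == deg [set: edge G]%SET u then degree_prod%:R else 0)
    <= (draw_share u)%:R * (deg F u)%:R :> R.
  case: eqP => [->|_]; last by rewrite mulr_ge0.
  by rewrite -natrM draw_shareK.
rewrite big_mkcond /= (bigD1 v) //= [ltRHS](bigD1 v) //=.
apply: ltr_leD; last by apply: ler_sum => u _; exact: le_u.
have degFv : (0 < deg F v < deg [set: edge G]%SET v)%N.
  apply/andP; split.
    by apply/card_gt0P; exists (top v); rewrite !inE vtop (topP v).1.
  rewrite deg_setT; apply: proper_card; apply/fintype.properP; split.
    by apply/fintype.subsetP => h; rewrite !inE => /andP[].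
  by exists f; rewrite !inE ?vf // (negbTE fF).
case/andP: degFv => Fv0 /ltn_eqF ->.
by rewrite mulr_gt0 // ltr0n // draw_share_gt0.
Qed.

End Ray.

(** * Steering from the ray to a target *)

Section Steering.
Variables (R : realType) (G : sgraph).
Implicit Types (x y z : config G) (e f g : edge G) (u v : G) (d : edge G -> R).
Local Notation b := (@bellman R G).
Local Notation "'u_ f" := (unit_cfg f) (at level 8, f at level 2).
Local Notation q := (@ray R G).

Hypothesis conn : connected_graph G.
Hypothesis noiso : forall v : G, exists f : edge G, incident v f.
Hypothesis G0 : (0 < #|G|)%N.

Lemma greedy_exists : exists top : (edge G -> R) -> G -> edge G,
  (forall d v, incident v (top d v)) /\
  (forall d v e, incident v e -> d e <= d (top d v)).
Proof.
have ex_top (p : (edge G -> R) * G) : exists t,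
    incident p.2 t /\ forall e, incident p.2 e -> p.1 e <= p.1 t.
  case: p => d v /=; have [f0 vf0] := noiso v.
  case: (@Order.TotalTheory.arg_maxP _ _ _ f0 (incident v) d vf0) => t vt tmax.
  by exists t; split.
have [top topP] := boolp.choice ex_top.
exists (fun d v => top (d, v)); split=> [d v|d v e].
  by have [] := topP (d, v).
by have [_] := topP (d, v); exact.
Qed.

Variable top : (edge G -> R) -> G -> edge G.
Hypothesis top_incident : forall d v, incident v (top d v).
Hypothesis top_ge : forall d v e, incident v e -> d e <= d (top d v).

Definition norm1 d : R := \sum_e `|d e|.
Definition norm2 d : R := \sum_e d e ^+ 2.

Definition greedy_step d v : edge G -> R := fun e => d e + q e - (e == top d v)%:R.

(** The expected distance to the line after [t] greedy rounds, from deviation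
    [d]. *)
Fixpoint deviation (t : nat) d : R :=
  if t is t'.+1 then mean (fun v => deviation t' (greedy_step d v)) else norm1 d.

Lemma deviation_ge0 t d : 0 <= deviation t d.
Proof.
elim: t d => [|t IH] d /=; first by rewrite sumr_ge0.
by apply: mean_ge => // v; exact: IH.
Qed.

Lemma sum_greedy_step d v : \sum_e greedy_step d v e = \sum_e d e.
Proof.
rewrite sumrB big_split /= sum_ray // (_ : \sum_e (e == _)%:R = 1) ?addrK //.
by rewrite (bigD1 (top d v)) //= eqxx big1 ?addr0 // => e /negbTE ->.
Qed.

(** The inverse rate of the restoring drift. *)
Definition drift : R := (period G)%:R * (#|edge G|%:R * #|G|.+1%:R).

(** Greedy play compares favourably with the ray: the load of the ray at a vertex
    is spread evenly over its edges, so it falls short of the largest value of [d]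
    by a multiple of [slack]. *)
Lemma greedy_drift d : \sum_e d e = 0 ->
  norm1 d <= drift * (mean (fun v => d (top d v)) - \sum_e d e * q e).
Proof.
move=> d0; apply: le_trans (norm1_slack (top_ge d) conn d0) _.
rewrite /drift [leRHS]mulrAC [leRHS]mulrC mulrA ler_wpM2l ?mulr_ge0 //.
have D0 : 0 < (period G)%:R :> R by rewrite ltr0n period_gt0.
rewrite mulrBr /mean.
have -> : (period G)%:R * (#|G|%:R^-1 * \sum_v d (top d v)) =
    \sum_v (degree_prod G)%:R * d (top d v).
  rewrite -mulr_sumr mulrA /period natrM; congr (_ * _).
  by rewrite mulrAC divff ?mul1r // pnatr_eq0 -lt0n.
have -> : (period G)%:R * \sum_e d e * q e = \sum_e d e * (edge_load e)%:R.
  rewrite mulr_sumr; apply: eq_bigr => e _.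
  by rewrite mulrC -mulrA rayM.
rewrite exchange_load -sumrB /slack; apply: ler_sum => v _.
rewrite -(draw_shareK v) natrM -mulrA -mulrBr.
have -> : (deg [set: edge G]%SET v)%:R * d (top d v) =
    \sum_(e | incident v e) d (top d v).
  by rewrite sumr_const deg_setT mulr_natl.
rewrite -sumrB ler_peMl ?ler1n ?draw_share_gt0 //.
by rewrite sumr_ge0 // => e ve; rewrite subr_ge0 top_ge.
Qed.

Lemma norm2_step d v : norm2 (greedy_step d v) <=
  norm2 d + 2 * (\sum_e d e * q e - d (top d v)) + #|edge G|%:R.
Proof.
have -> : d (top d v) = \sum_e d e * (e == top d v)%:R.
  rewrite (bigD1 (top d v)) //= eqxx mulr1 big1 ?addr0 // => e /negbTE ->.
  by rewrite mulr0.
have -> : #|edge G|%:R = \sum_(e : edge G) (1 : R) by rewrite sumr_const.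
rewrite -sumrB mulr_sumr -!big_split /=; apply: ler_sum => e _.
rewrite /greedy_step.
have := @ray_ge0 R G e; have := @ray_le1 R G noiso G0 e; move: (q e) (d e) => r s.
by case: (_ == _) => /= r0 r1; nra.
Qed.

(** By [greedy_drift], [norm2] is expected to decrease by a multiple of [norm1] in
    each round, up to a bounded error.  As [norm2] stays nonnegative, these decreases
    add up to at most [norm2 d] plus the errors. *)
Lemma sum_deviation s d : \sum_e d e = 0 ->
  2 * \sum_(0 <= t < s) deviation t d <= drift * (norm2 d + #|edge G|%:R * s%:R).
Proof.
have drift0 : 0 <= drift by rewrite !mulr_ge0.
elim: s d => [|s IH] d d0.
  by rewrite big_nil !mulr0 addr0 mulr_ge0 // sumr_ge0 // => e _; rewrite sqr_ge0.
rewrite big_nat_recl // -mean_sum_nat mulrDr -[X in _ + X]meanZ.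
have step v : 2 * \sum_(0 <= t < s) deviation t (greedy_step d v) <=
    drift * (norm2 d + 2 * (\sum_e d e * q e - d (top d v)) +
             #|edge G|%:R * s.+1%:R).
  apply: le_trans (IH _ _) _; first by rewrite sum_greedy_step.
  apply: ler_wpM2l => //; have := norm2_step d v; rewrite -[s.+1%:R]natr1 [_ * (_ + 1)]mulrDr mulr1.
  by move=> h; rewrite [leRHS]addrCA [leLHS]addrC lerD2l.
have := ler_mean step => /(lerD (lexx (2 * norm1 d)))/le_trans; apply.
have := greedy_drift d0; rewrite meanZ meanD meanD !mean_const // meanZ meanB mean_const //.
rewrite -[s.+1%:R]natr1.
move: (mean _) (\sum_e _) (norm1 d) (norm2 d) (_ * (_ + 1)) => a c n1 n2 k.
by move: (drift) => r; lra.
Qed.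


(** A lower bound that is affine in the distance survives the averaging over the
    draws, so greedy play carries it from size [m] along the line through [z]. *)
Lemma greedy_play m z (th K : R) : 0 <= th -> 0 < K -> size_cfg z = m%:Z ->
  (forall y, size_cfg y = m%:Z ->
     th * (1 - norm1 (fun e => ((y - z) e)%:~R) / K) <= b m y) ->
  forall t y, size_cfg y = (t + m)%:Z ->
  th * (1 - deviation t (fun e => ((y - z) e)%:~R - t%:R * q e) / K) <=
    b (t + m) y.
Proof.
move=> th0 K0 sz Hz; elim=> [|t IH] y sy.
  rewrite add0n; apply: le_trans (Hz y sy); rewrite /deviation.
  rewrite [X in norm1 X](_ : _ = fun e => ((y - z) e)%:~R) //.
  by apply/funext => e; rewrite mul0r subr0.
set d := (fun e => _ - t.+1%:R * q e).
rewrite addSn; apply: le_trans (@bellmanS_ge R G (t + m) y (top d) (top_incident d)).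
apply: le_trans (_ : mean (fun v => th * (1 - deviation t (greedy_step d v) / K)) <= _).
  rewrite meanZ meanB mean_const // [mean (fun v => _ / K)](_ : _ =
    mean (fun v => deviation t (greedy_step d v)) / K) //.
  by rewrite [RHS]mulrC -meanZ; apply: eq_mean => v; rewrite mulrC.
apply: ler_mean => v.
have sy' : size_cfg (y - 'u_(top d v)) = (t + m)%:Z by exact: size_step.
have := IH _ sy'.
rewrite [X in deviation t X](_ : _ = greedy_step d v) //.
apply/funext => e; rewrite /greedy_step /d !cfgB unit_cfgE -[t.+1%:R]natr1.
rewrite !rmorphB /= mulrDl mul1r; move: ((y e)%:~R : R) ((z e)%:~R : R) (t%:R * q e) (q e) => a c r s.
by case: (_ == _); rewrite /= ?mulr1z ?mulr0z; lra.
Qed.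


Lemma sum_subseq (h : nat -> R) (t0 D J : nat) : (0 < D)%N ->
  (forall t, 0 <= h t) ->
  \sum_(0 <= i < J) h (t0 + i * D)%N <= \sum_(0 <= t < t0 + J * D) h t.
Proof.
move=> D0 h0; elim: J => [|J IH].
  by rewrite big_geq // sumr_ge0.
rewrite big_nat_recr //= [leRHS](big_cat_nat (n := t0 + J * D)) //=; last first.
  by rewrite mulSn addnCA leq_addl.
apply: lerD => //; rewrite big_ltn; last first.
  by rewrite mulSn addnCA -[X in (X < _)%N]add0n ltn_add2r.
by rewrite lerDl sumr_ge0.
Qed.

Definition ray_cfg (j : nat) : config G := [ffun e => (j * edge_load e)%:Z].

Lemma size_ray_cfg j : size_cfg (ray_cfg j) = (j * period G)%:Z.
Proof.
have sum_load : (\sum_(e : edge G) edge_load e)%N = period G.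
  apply/eqP; rewrite -(eqr_nat R) natr_sum; apply/eqP.
  transitivity (\sum_e q e * (period G)%:R).
    by apply: eq_bigr => e _; rewrite rayM.
  by rewrite -mulr_suml sum_ray // mul1r.
rewrite /size_cfg -sum_load big_distrr /= (big_morph Posz PoszD (erefl _)).
by apply: eq_bigr => e _; rewrite ffunE.
Qed.

(** All points of the ray at multiples of [period] have the same deviation [d0] from
    the line through the target, so the values on the ray bound [deviation] from
    below along an arithmetic progression of times.  If [c < M], this lower bound is
    proportional to [K] and contradicts [sum_deviation], whose main term does not
    involve [K] or the target. *)
Lemma ray_value_ge (M c : R) : 0 < c ->
  (forall (K : nat) (ep : R), 0 < ep ->
    exists m z, size_cfg z = m%:Z /\ forall y, size_cfg y = m%:Z ->
      (forall e, `|(y - z) e| <= K%:Z) -> M - ep <= b m y) ->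
  (forall ep : R, 0 < ep -> exists j0, forall j, (j0 <= j)%N ->
    b (j * period G) (ray_cfg j) <= c + ep) ->
  M <= c.
Proof.
move=> c0 robust on_ray; rewrite leNgt; apply/negP => cM.
have [ep ep0 epE] : exists2 ep : R, 0 < ep & 4 * ep = M - c.
  by exists ((M - c) / 4); [rewrite divr_gt0 ?subr_gt0 | lra].
have th0 : 0 < M - ep by lra.
have [r r0 rE] : exists2 r : R, 0 < r & (M - ep) * (1 - r) = c + ep.
  exists (1 - (c + ep) / (M - ep)).
    by rewrite subr_gt0 ltr_pdivrMr // mul1r; lra.
  by rewrite subKr mulrC divfK //; apply: lt0r_neq0.
have D0 := period_gt0 noiso G0.
have E_drift : 0 <= drift * (#|edge G|%:R * (period G)%:R) by rewrite !mulr_ge0.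
have [K K0 KP] : exists2 K : nat, (0 < K)%N &
    drift * (#|edge G|%:R * (period G)%:R) < 2 * (K%:R * r).
  move: E_drift; move: (drift * _) => w w0; exists (Num.bound (w / r)).+1 => //.
  have : w / r < (Num.bound (w / r))%:R by rewrite archi_boundP // divr_ge0 // ltW.
  rewrite ltr_pdivrMr // -[X in _ < 2 * (X * _)]natr1.
  by move: ((Num.bound (w / r))%:R) => n wn; nra.
have KR : 0 < K%:R :> R by rewrite ltr0n.
have [j0 j0P] := on_ray ep ep0; have [m [z [sz near]]] := robust K ep ep0.
pose d0 : edge G -> R := fun e => m%:R * q e - (z e)%:~R.
have sum_d0 : \sum_e d0 e = 0.
  rewrite sumrB -mulr_sumr sum_ray // mulr1 -(rmorph_sum (intmul (1 : R))) /=.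
  by rewrite -/(size_cfg z) sz subrr.
have target y : size_cfg y = m%:Z ->
    (M - ep) * (1 - norm1 (fun e => ((y - z) e)%:~R) / K%:R) <= b m y.
  move=> sy; have [nK|nK] := lerP (norm1 (fun e => ((y - z) e)%:~R)) K%:R.
    apply: le_trans (near y sy _).
      rewrite ler_piMr ?(ltW th0) // gerBl divr_ge0 ?(ltW KR) //.
      exact: sumr_ge0.
    move=> e; rewrite -(ler_int R) intr_norm; apply: le_trans nK.
    by rewrite /norm1 (bigD1 e) //= lerDl sumr_ge0.
  apply: le_trans (bellman_ge0 _ _ _).
  by rewrite pmulr_rle0 // subr_le0 ler_pdivlMr // mul1r ltW.
pose j1 := maxn j0 m.
have mj i : (m <= (j1 + i) * period G)%N.
  apply: leq_trans (leq_pmulr _ D0); apply: leq_trans (leq_addr i j1).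
  exact: leq_maxr.
have large i : K%:R * r <= deviation ((j1 * period G - m) + i * period G) d0.
  have tE : (j1 * period G - m + i * period G + m = (j1 + i) * period G)%N.
    by rewrite addnAC subnK ?mulnDl //; have := mj 0%N; rewrite addn0.
  have := greedy_play (ltW th0) KR sz target (y := ray_cfg (j1 + i))
    (t := (j1 * period G - m) + i * period G).
  rewrite tE => /(_ (size_ray_cfg _)).
  rewrite [X in deviation _ X](_ : _ = d0); last first.
    apply/funext => e; rewrite /d0 cfgB ffunE rmorphB /=.
    have -> : ((j1 + i) * edge_load e)%:Z%:~R =
        ((j1 + i) * period G)%:R * q e.
      by rewrite natrM -mulrA (mulrC (period G)%:R) rayM // -natrM.
    rewrite -tE [in X in X * q e - _]natrD.
    by move: (_%:~R) (_%:R) (_%:R) (q e) => a1 a2 a3 a4; lra.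
  have := j0P (j1 + i)%N (leq_trans (leq_maxl j0 m) (leq_addr i j1)).
  move: (b _ _) (deviation _ _) => u w uc /le_trans/(_ uc).
  rewrite -rE ler_pM2l // lerD2l lerN2 ler_pdivlMr // mulrC.
  by [].
have bound (J : nat) : 2 * (J%:R * (K%:R * r)) <= drift * (norm2 d0 +
    #|edge G|%:R * (j1 * period G - m + J * period G)%:R).
  apply: le_trans (sum_deviation _ sum_d0); apply: ler_wpM2l => //.
  apply: le_trans (sum_subseq _ _ D0 (fun t => deviation_ge0 t d0)).
  rewrite -[in leLHS](card_ord J) mulr_natl -sumr_const big_mkord.
  by apply: ler_sum => i _; exact: large.
have gap : 0 < 2 * (K%:R * r) - drift * (#|edge G|%:R * (period G)%:R).
  by rewrite subr_gt0.
pose Y := drift * (norm2 d0 + #|edge G|%:R * (j1 * period G - m)%:R).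
have linear (J : nat) : J%:R * (2 * (K%:R * r) -
    drift * (#|edge G|%:R * (period G)%:R)) <= Y.
  have := bound J; rewrite /Y natrD natrM; move: (_%:R * r) (_ - m)%:R => k t.
  by move: (norm2 d0) (#|edge G|%:R) (period G)%:R (J%:R) (drift) => n E D j a; lra.
have Y0 : 0 <= Y by apply: le_trans (linear 0%N); rewrite mul0r.
have := linear (Num.bound (Y / (2 * (K%:R * r) -
  drift * (#|edge G|%:R * (period G)%:R)))).
rewrite leNgt => /negP; apply; rewrite -ltr_pdivrMr //.
by rewrite archi_boundP // divr_ge0 // ltW.
Qed.

End Steering.

(** * Convergence of the maximal value *)

Section RayConfigs.
Variables (R : realType) (G : sgraph) (e0 : edge G).
Hypothesis noiso : forall v : G, exists f : edge G, incident v f.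
Hypothesis G0 : (0 < #|G|)%N.

(** The ray is integral only at multiples of [period]; elsewhere the remainder is
    put on [e0], which keeps the distance to the ray bounded. *)
Definition near_ray_cfg (n : nat) : config G :=
  ray_cfg G (n %/ period G)%N + [ffun e => (if e == e0 then (n %% period G)%N else 0%N)%:Z].

Lemma near_ray_cfgE n e : near_ray_cfg n e =
  (n %/ period G * edge_load e + (if e == e0 then n %% period G else 0))%N%:Z.
Proof. by rewrite cfgD !ffunE PoszD. Qed.

Lemma nonneg_near_ray_cfg n : nonneg (near_ray_cfg n).
Proof. by move=> e; rewrite near_ray_cfgE. Qed.

Lemma size_near_ray_cfg n : size_cfg (near_ray_cfg n) = n%:Z.
Proof.
rewrite size_cfgD (size_ray_cfg R noiso G0) /size_cfg (bigD1 e0) //= ffunE eqxx.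
rewrite big1 => [|e /negbTE ee0]; last by rewrite ffunE ee0.
by rewrite addr0 -PoszD -divn_eq.
Qed.

Lemma near_ray_cfg_mul j : near_ray_cfg (j * period G) = ray_cfg G j.
Proof.
apply/ffunP => e; rewrite near_ray_cfgE mulnK ?period_gt0 // modnMl.
by rewrite [RHS]ffunE; case: (_ == _); rewrite addn0.
Qed.

Lemma near_ray_cfg_dist n e :
  `|(near_ray_cfg n e)%:~R - n%:R * ray R e| <= (period G)%:R.
Proof.
rewrite near_ray_cfgE [X in _ - X%:R * _](divn_eq n (period G)) natrD natrM mulrDl -mulrA.
rewrite [(period G)%:R * _]mulrC rayM // PoszD rmorphD /= -natrM.
have rD : (n %% period G)%N%:R <= (period G)%:R :> R.
  by rewrite ler_nat ltnW // ltn_pmod // period_gt0.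
have r0 : 0 <= (n %% period G)%N%:R :> R by [].
have := ray_ge0 R e; have := ray_le1 R noiso G0 e.
set s := (if _ then _ else _); have : s%:R = 0 :> R \/ s%:R = (n %% period G)%N%:R :> R.
  by rewrite /s; case: (_ == _); [right | left].
rewrite -!pmulrn; move: s%:R rD r0 => w.
move: (n %% period G)%N%:R (period G)%:R (_ * _)%:R (ray R e) => r D a q rD r0.
by move=> [->|->] q1 q0; rewrite ler_norml; apply/andP; split; nra.
Qed.

End RayConfigs.

Local Open Scope classical_set_scope.

Theorem corollary3 (R : realType) (G : sgraph)
    (hconn : connected_graph G) (hE : (2 <= #|edge G|)%N)
    (c : R) (hc : is_cG G c)
    (N : nat -> config G)
    (hN : forall n : nat, (1 <= n)%N -> maximizes_pG R n (N n)) :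
  pG R (N n) @[n --> \oo] --> c.
Proof.
have noiso := connected_incident hconn (ltnW hE).
have /card_gt0P[e0 _] : (0 < #|edge G|)%N by exact: ltnW.
have [v0 _] := edge_endpoint e0.
have G0 : (0 < #|G|)%N by apply/card_gt0P; exists v0.
have [c0 cvg_c] := hc.
have pGb n (x : config G) : size_cfg x = n%:Z -> pG R x = bellman R n x.
  by move=> sx; rewrite (@pGE R G noiso) sx.
have sN n : size_cfg (N n.+1) = n.+1%:Z by have [] := hN n.+1 isT.
have le_top n (x : config G) : size_cfg x = n.+1%:Z -> bellman R n.+1 x <= pG R (N n.+1).
  move=> sx; have [_ _ top] := hN n.+1 isT.
  have [x0|x0] := pselect (nonneg x); first by rewrite -(pGb _ _ sx); exact: top.
  by rewrite bellman_not_nonneg // (pGb _ _ (sN n)) bellman_ge0.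
pose u n := pG R (N n.+1).
have u_mono : nonincreasing_seq u.
  apply/nonincreasing_seqP => n; rewrite /u (pGb _ _ (sN n.+1)).
  have [opt [_ ->]] := optimal_play R noiso.
  by apply: mean_le => // v; apply: le_top; exact: size_step.
have u_lb : has_lbound (range u).
  by exists 0 => _ [n _ <-]; rewrite /u (pGb _ _ (sN n)) bellman_ge0.
have u_cvg := nonincreasing_cvgn u_mono u_lb.
set M := inf (range u) in u_cvg.
have M_le n : M <= u n by apply: ge_inf => //; exists n.
have M_top (d : R) : 0 < d -> exists m, forall n (x : config G), (m <= n)%N ->
    size_cfg x = n%:Z -> bellman R n x <= M + d.
  move=> d0.
  have /(inf_lt (ex_intro _ (u 0%N) (ex_intro2 _ _ 0%N I erefl)))[_ [m _ <-] um] :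
    inf (range u) < M + d by rewrite ltrDl.
  exists m.+1 => -[//|n] x; rewrite ltnS => mn sx.
  by apply: le_trans (le_top n x sx) (le_trans (u_mono _ _ mn) (ltW um)).
have ray_cvg := cvg_c _ (ray_in_R R hconn noiso G0) (near_ray_cfg e0)
  (nonneg_near_ray_cfg e0) (size_near_ray_cfg R e0 noiso G0).
have {}ray_cvg : pG R (near_ray_cfg e0 n) @[n --> \oo] --> c.
  by apply: ray_cvg; exists (period G)%:R; exact: near_ray_cfg_dist.
have near_c (d : R) : 0 < d -> exists m, forall n, (m <= n)%N ->
    `|c - bellman R n (near_ray_cfg e0 n)| < d.
  move=> d0; have /cvgrPdist_lt/(_ d d0)[m _ H] := ray_cvg.
  exists m => n mn; rewrite -(pGb _ _ (size_near_ray_cfg R e0 noiso G0 n)).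
  exact: H.
have cM : c <= M.
  rewrite leNgt; apply/negP => Mc.
  have d0 : 0 < (c - M) / 2 by rewrite divr_gt0 ?subr_gt0.
  have [m1 m1P] := M_top _ d0; have [m2 m2P] := near_c _ d0.
  have := m1P (maxn m1 m2) _ (leq_maxl _ _) (size_near_ray_cfg R e0 noiso G0 _).
  have := m2P (maxn m1 m2) (leq_maxr _ _).
  by move: (bellman _ _ _) => w; rewrite ltr_norml => /andP[]; lra.
have M0 : 0 < M by exact: lt_le_trans cM.
have M_near n : (0 < n)%N ->
    exists x : config G, [/\ nonneg x, size_cfg x = n%:Z & M <= bellman R n x].
  case: n => // n _; exists (N n.+1); have [x0 sx _] := hN n.+1 isT.
  by split=> //; rewrite -pGb //; exact: M_le.
have [top [topi top_ge]] := greedy_exists R noiso.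
have Mc : M <= c.
  apply: (ray_value_ge hconn noiso G0 topi top_ge c0).
    by move=> K ep; exact: (robust_target noiso G0 M0 M_top M_near).
  move=> ep ep0; have [m H] := near_c _ ep0.
  exists m => j mj; rewrite -(near_ray_cfg_mul e0 noiso G0).
  have := H (j * period G)%N (leq_trans mj (leq_pmulr _ (period_gt0 noiso G0))).
  by move: (bellman _ _ _) => w; rewrite ltr_norml => /andP[]; lra.
have <- : M = c by apply/eqP; rewrite eq_le Mc cM.
by rewrite -cvg_shiftS; exact: u_cvg.
Qed.
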